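(* Suppose the Lipschitz assumption (with constants $L_G,L_H\in(0,\infty)$) holds. Let $D_{\mathcal X}:=\sup_{u,v\in\mathcal X}\|u-v\|_2<\infty$, let $\hat x$ be a Slater point, i.e. $t:=\min_{i\in\{1,\dots,q\}}a_i(\hat x)>0$, and let $$\lambda:=\frac{\kappa D_{\mathcal X}\mu_1+\sqrt{\kappa^2D_{\mathcal X}^2\mu_1^2+4t\left(f(\hat x)-f_\star+\kappa q\mu_1+t\right)}}{2t},\qquad W:=\kappa\left(q+D_{\mathcal X}\lambda\right).$$ Then, for any $\epsilon\in(0,\infty)$, there exists an iterate $\bar{\bar x}_{J+1}$ of Algorithm B with $$J\le 2+\log_{1/\sigma}\left(\frac{W\mu_1}{\epsilon}+\frac1\sigma\right)$$ such that $f(\bar{\bar x}_{J+1})-f_\star\le\epsilon$, and the total number of regularized Newton steps used in Algorithm B to compute $\bar{\bar x}_{J+1}$ is at most $$\frac{8L_G^{2/3}W^{5/3}}{(1-C)^{2/3}\eta_1^{4/3}\,C\gamma\,(1-\sigma^{2/3})}\,\epsilon^{-2/3}+\ell(\epsilon),$$ where $$\ell(\epsilon):=\frac{WJ}{C\gamma}\,r(W^{-1}\epsilon)+J+\frac{\psi_{\mu_1}(\bar{\bar x}_1)-\psi_{\mu_1}^\star}{C\gamma\mu_1}\left(\frac{8L_G^{2/3}}{(1-C)^{2/3}\eta_1^{4/3}}\mu_1^{-2/3}+r(\mu_1)\right),$$ $$r(\mu):=128+\frac{12800}{(1-C)^2}+\left(\frac{2\sqrt{2L_G}}{\eta_1}+\frac{L_H^{1/2}}{(1-C)^{1/2}\eta_1^{3/2}}\right)\mu^{-1/2}+\frac{40^{1/5}L_G^{3/5}}{(1-C)^{1/5}\eta_1^{6/5}}\mu^{-3/5}.$$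 In particular $r(\mu)=O(\mu^{-3/5})$ as $\mu\to0$ and $\ell(\epsilon)=O(\log(1/\epsilon)\,\epsilon^{-3/5})$ as $\epsilon\to 0$.
   Context: **Problem.** $f:\mathbb R^n\to\mathbb R$ is convex, $a:\mathbb R^n\to\mathbb R^q$ has concave components $a_1,\dots,a_q$, $\mathcal X:=\{x\in\mathbb R^n: a(x)\ge 0\}$, $\operatorname{int}\mathcal X:=\{x: a(x)>0\}$ (componentwise), $f_\star:=\inf_{x\in\mathcal X}f(x)$. For $\mu>0$, $\psi_\mu(x):=f(x)-\mu\sum_{i=1}^q\log a_i(x)$, with $\psi_\mu(x)=+\infty$ if some $a_i(x)\le 0$, and $\psi_\mu^\star:=\inf_{x\in\mathcal X}\psi_\mu(x)$. $\mathcal L(x,y):=f(x)-y^\top a(x)$ is the Lagrangian; $\nabla a(x)$ is the $q\times n$ Jacobian; $\mathbf 1$ is the all-ones vector. **Lipschitz assumption.** $f$ and each $a_i$ are thrice differentiable on $\mathbb R^n$ and on $\mathcal X$ each of them has $L_G$-Lipschitz first derivative and $L_H$-Lipschitz second derivative. **Constants.** $C\in(0,1/2)$, $\gamma\in(0,1)$, $\eta_1\in(0,1/2)$, $\eta_2\in(\eta_1,1/2)$ with $2\eta_2+\frac58(1-C)\eta_1\le\sqrt{7/8}$; $\kappa\in(2,\infty)$ and $\sigma\in[2/\kappa,1)$. **$\mu$-approximate first-order stationary interior point (SIP).** A pair $(x,y)$ with $a(x)>0$, $y>0$, $|y_ia_i(x)-\mu|\le\mu/2$ for all $i$, and $\|\nabla_x\mathcal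 L(x,y)\|_2\le\mu\sqrt{\|y\|_1+1}$. **Algorithm A (fixed barrier parameter).** Input $x_1\in\operatorname{int}\mathcal X$, $\mu>0$. For $k=1,2,\dots$: (I) Put $S_k:=\operatorname{diag}(a(x_k))$, $y_k:=\mu S_k^{-1}\mathbf 1$, $Y_k:=\operatorname{diag}(y_k)$. If $(x_k,y_k)$ is a $\mu$-approximate SIP, stop and return it. (Step) Let $\varepsilon_k:=\mu\sqrt{1+\|y_k\|_1}$, $\mathcal M_k(d):=\nabla\psi_\mu(x_k)^\top d+\frac12d^\top\nabla^2\psi_\mu(x_k)d$. Choose $\delta_k\ge 0$ and $d^x_k$ with $(\nabla^2\psi_\mu(x_k)+\delta_kI)d^x_k=-\nabla\psi_\mu(x_k)$, $\eta_1\le\frac{-\mathcal M_k(d^x_k)}{\varepsilon_k\|d^x_k\|_2}$, and either $\psi_\mu(x_k+d_k^x)>\psi_\mu(x_k)+C\mathcal M_k(d_k^x)$ or $\frac{\|d^x_k\|_2\delta_k}{2\varepsilon_k}\le\eta_2$. Choose $\alpha_k\in(0,1]$ with $\psi_\mu(x_k+\alpha_kd^x_k)\le\psi_\mu(x_k)+C\mathcal M_k(\alpha_kd^x_k)$ and such that either $\alpha_k=1$ or, with $\hat\alpha_k=\min\{1,\alpha_k/\gamma\}$, $\psi_\mu(x_k+\hat\alpha_kd^x_k)>\psi_\mu(x_k)+C\mathcal M_k(\hat\alpha_kd^x_k)$. Set $x_{k+1}=x_k+\alpha_kd^x_k$. (II) Put $d^s_k:=\nabla a(x_k)d^x_k$,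 $d^y_k:=-Y_kS_k^{-1}d^s_k$, $\hat y_{k+1}:=y_k+d^y_k$. If $(x_{k+1},\hat y_{k+1})$ is a $\mu$-approximate SIP, stop and return it. **Algorithm B (annealing).** Input $\bar{\bar x}_1\in\operatorname{int}\mathcal X$, $\mu_1\in(0,\infty)$. For $j=1,2,\dots$: run Algorithm A from $\bar{\bar x}_j$ with barrier parameter $\mu_j$ to get $(\bar x_{j+1},\bar y_{j+1})$; then find any $(\bar{\bar x}_{j+1},\bar{\bar y}_{j+1})$ and $\mu_{j+1}>0$ with $\mu_{j+1}\le\sigma\mu_j$, $a(\bar{\bar x}_{j+1})\ge 0$, $\|\nabla_x\mathcal L(\bar{\bar x}_{j+1},\bar{\bar y}_{j+1})\|_2\le\kappa\mu_{j+1}\sqrt{1+\|\bar{\bar y}_{j+1}\|_1}$ and $\frac1\kappa\le\frac{a_i(\bar{\bar x}_{j+1})[\bar{\bar y}_{j+1}]_i}{\mu_{j+1}}\le\kappa$ for all $i$ (here $\|\bar{\bar y}_{j+1}\|_1$ is the $\ell_1$ norm). One regularized Newton step is one iteration of Algorithm A; the total number of regularized Newton steps to compute $\bar{\bar x}_{J+1}$ is the total over outer iterations $j=1,\dots,J$. *)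

(* Defs.v *)
(* Points of R^n and R^q are row vectors. *)
From HB Require Import structures.
From mathcomp Require Export all_boot all_order all_algebra.
From mathcomp Require Export all_classical all_reals all_analysis.

Export Order.TTheory GRing.Theory Num.Theory.
Export numFieldNormedType.Exports.

#[export] Set Implicit Arguments.
#[export] Unset Strict Implicit.
#[export] Unset Printing Implicit Defensive.

Local Open Scope classical_set_scope.
Local Open Scope ring_scope.

Section Euclidean.
Context {R : realType}.

Definition dot n (u v : 'rV[R]_n) : R := \sum_i u 0 i * v 0 i.

(* The library norm `|u| on 'rV[R]_n is the max norm, hence these two. *)
Definition norm1 n (u : 'rV[R]_n) : R := \sum_i `|u 0 i|.
Definition norm2 n (u : 'rV[R]_n) : R := Num.sqrt (\sum_i u 0 i ^+ 2).

Definition opnorm2 n (A : 'M[R]_n) : R :=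
  sup [set norm2 (w *m A) | w in [set w : 'rV[R]_n | norm2 w <= 1]].

Definition diameter n (X : set 'rV[R]_n) : R :=
  sup [set norm2 (p.1 - p.2) | p in X `*` X].

Definition bounded_diameter n (X : set 'rV[R]_n) : Prop :=
  has_ubound [set norm2 (p.1 - p.2) | p in X `*` X].

Definition grad n (g : 'rV[R]_n -> R) (x : 'rV[R]_n) : 'rV[R]_n :=
  \row_j 'D_(delta_mx 0 j) g x.

(* With the row-vector convention of 'J, [d *m hess g x] is the derivative of
   [grad g] at [x] in the direction [d]. *)
Definition hess n (g : 'rV[R]_n -> R) (x : 'rV[R]_n) : 'M[R]_n :=
  'J (grad g) x.

Definition thrice_differentiable n (g : 'rV[R]_n -> R) : Prop :=
  [/\ forall x, differentiable g x,
      forall x, differentiable (grad g) x &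
      forall x, differentiable (hess g) x].

Definition lipschitz_derivatives n (X : set 'rV[R]_n) (LG LH : R)
    (g : 'rV[R]_n -> R) : Prop :=
  forall u v, X u -> X v ->
    norm2 (grad g u - grad g v) <= LG * norm2 (u - v) /\
    opnorm2 (hess g u - hess g v) <= LH * norm2 (u - v).

End Euclidean.

Section Problem.
Context {R : realType} {n q : nat}.
Variables (f : 'rV[R]_n -> R) (a : 'rV[R]_n -> 'rV[R]_q).

Definition feasible : set 'rV[R]_n := [set x | forall i, 0 <= a x 0 i].
Definition strictly_feasible : set 'rV[R]_n := [set x | forall i, 0 < a x 0 i].

Definition fstar : R := inf (f @` feasible).

Definition smooth_assumption (LG LH : R) : Prop :=
  (thrice_differentiable f /\ lipschitz_derivatives feasible LG LH f) /\
  forall i, thrice_differentiable (fun x => a x 0 i) /\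
            lipschitz_derivatives feasible LG LH (fun x => a x 0 i).

Definition lagrangian (x : 'rV[R]_n) (y : 'rV[R]_q) : R := f x - dot y (a x).

Definition log_barrier (mu : R) (x : 'rV[R]_n) : R :=
  f x - mu * \sum_i ln (a x 0 i).

Definition psi (mu : R) (x : 'rV[R]_n) : \bar R :=
  if [forall i, 0 < a x 0 i] then (log_barrier mu x)%:E else +oo%E.

Definition psi_star (mu : R) : \bar R := ereal_inf (psi mu @` feasible).

(* [psi] and [log_barrier] agree near every strictly feasible point; the
   derivatives below are only ever taken at such points. *)
Definition grad_psi (mu : R) (x : 'rV[R]_n) := grad (log_barrier mu) x.
Definition hess_psi (mu : R) (x : 'rV[R]_n) := hess (log_barrier mu) x.

Definition model (mu : R) (x d : 'rV[R]_n) : R :=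
  dot (grad_psi mu x) d + 2^-1 * dot d (d *m hess_psi mu x).

(* [(x, y)] is a [mu]-approximate first-order stationary interior point. *)
Definition approx_SIP (mu : R) (x : 'rV[R]_n) (y : 'rV[R]_q) : Prop :=
  [/\ forall i, 0 < a x 0 i,
      forall i, 0 < y 0 i,
      forall i, `|y 0 i * a x 0 i - mu| <= mu / 2 &
      norm2 (grad (lagrangian ^~ y) x) <= mu * Num.sqrt (norm1 y + 1)].

Definition dual (mu : R) (x : 'rV[R]_n) : 'rV[R]_q := \row_i (mu / a x 0 i).

(* y + d^y with d^y = - Y S^-1 (Jacobian of a at x) d. *)
Definition dual_next (mu : R) (x d : 'rV[R]_n) : 'rV[R]_q :=
  \row_i (dual mu x 0 i - dual mu x 0 i / a x 0 i * (d *m 'J a x) 0 i).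

Variables (C gamma eta1 eta2 kappa sigma : R).

(* If [d = 0] the third condition reads [eta1 <= 0] and is false for the
   admissible [eta1], so dividing by [norm2 d] is harmless. *)
Definition newton_direction (mu : R) (x : 'rV[R]_n) (delta : R)
    (d : 'rV[R]_n) : Prop :=
  let eps := mu * Num.sqrt (1 + norm1 (dual mu x)) in
  [/\ 0 <= delta,
      d *m (hess_psi mu x + delta%:M) = - grad_psi mu x,
      eta1 <= - model mu x d / (eps * norm2 d) &
      (psi mu (x + d) > psi mu x + (C * model mu x d)%:E)%E \/
      norm2 d * delta / (2 * eps) <= eta2].

Definition step_size (mu : R) (x d : 'rV[R]_n) (alpha : R) : Prop :=
  let alpha' := Num.min 1 (alpha / gamma) in
  [/\ 0 < alpha, alpha <= 1,
      (psi mu (x + alpha *: d) <=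
         psi mu x + (C * model mu x (alpha *: d))%:E)%E &
      alpha = 1 \/
      (psi mu (x + alpha' *: d) >
         psi mu x + (C * model mu x (alpha' *: d))%:E)%E].

(* The fixed-barrier algorithm with parameter [mu]: from the iterate [x], one
   iteration either returns a pair or goes on with a new iterate. *)
Inductive outcome :=
  | Return of 'rV[R]_n & 'rV[R]_q
  | Continue of 'rV[R]_n.

Inductive inner_iteration (mu : R) (x : 'rV[R]_n) : outcome -> Prop :=
  | StopBeforeStep :
      approx_SIP mu x (dual mu x) ->
      inner_iteration mu x (Return x (dual mu x))
  | StopAfterStep delta d alpha :
      ~ approx_SIP mu x (dual mu x) ->
      newton_direction mu x delta d -> step_size mu x d alpha ->
      approx_SIP mu (x + alpha *: d) (dual_next mu x d) ->
      inner_iteration mu x (Return (x + alpha *: d) (dual_next mu x d))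
  | NoStop delta d alpha :
      ~ approx_SIP mu x (dual mu x) ->
      newton_direction mu x delta d -> step_size mu x d alpha ->
      ~ approx_SIP mu (x + alpha *: d) (dual_next mu x d) ->
      inner_iteration mu x (Continue (x + alpha *: d)).

(* The new starting point [x'] (with multipliers [y']) and barrier parameter
   [mu'] the annealing algorithm may choose once the fixed-barrier algorithm
   with parameter [mu] has returned. *)
Definition annealing_update (mu : R) (x' : 'rV[R]_n) (y' : 'rV[R]_q)
    (mu' : R) : Prop :=
  [/\ 0 < mu', mu' <= sigma * mu, forall i, 0 <= a x' 0 i,
      norm2 (grad (lagrangian ^~ y') x') <=
        kappa * mu' * Num.sqrt (1 + norm1 y') &
      forall i, kappa^-1 <= a x' 0 i * y' 0 i / mu' /\
                a x' 0 i * y' 0 i / mu' <= kappa].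

(* The annealing algorithm, about to perform iteration [inner] of the
   fixed-barrier run of outer iteration [outer] (both counted from 1), with
   barrier parameter [barrier] and current iterate [point].  When [inner = 1],
   [point] is the starting point of outer iteration [outer]. *)
Record state := State {
  outer : nat; inner : nat; barrier : R; point : 'rV[R]_n }.

(* Every transition performs exactly one fixed-barrier iteration, i.e. one
   regularized Newton step. *)
Inductive transition : state -> state -> Prop :=
  | InnerTransition j k mu x x' :
      inner_iteration mu x (Continue x') ->
      transition (State j k mu x) (State j k.+1 mu x')
  | OuterTransition j k mu x xbar ybar x' y' mu' :
      inner_iteration mu x (Return xbar ybar) ->
      annealing_update mu x' y' mu' ->
      transition (State j k mu x) (State j.+1 1 mu' x').

(* The annealing algorithm has no stopping rule.  It is not built in that the
   fixed-barrier runs terminate: the outer counter of an execution may a priori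
   stay constant from some time on. *)
Definition execution (x1 : 'rV[R]_n) (mu1 : R) (s : nat -> state) : Prop :=
  s 0%N = State 1 1 mu1 x1 /\ forall N, transition (s N) (s N.+1).

(* [x] is the starting point of outer iteration [j] and it is available after a
   total of [N] regularized Newton steps over outer iterations 1, ..., j - 1. *)
Definition reaches (s : nat -> state) (j : nat) (x : 'rV[R]_n) (N : nat) :=
  [/\ outer (s N) = j, inner (s N) = 1%N & point (s N) = x].

End Problem.

Section Bounds.
Context {R : realType}.

(* [gap] is f(xhat) - fstar. *)
Definition lambda_bound (q : nat) (kappa D mu1 t gap : R) : R :=
  (kappa * D * mu1 +
   Num.sqrt (kappa ^+ 2 * D ^+ 2 * mu1 ^+ 2 +
             4 * t * (gap + kappa * q%:R * mu1 + t))) / (2 * t).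

Definition W_bound (q : nat) (kappa D lambda : R) : R :=
  kappa * (q%:R + D * lambda).

Definition r_bound (C eta1 LG LH mu : R) : R :=
  128 + 12800 / (1 - C) ^+ 2 +
  (2 * Num.sqrt (2 * LG) / eta1 +
   LH `^ (1 / 2) / ((1 - C) `^ (1 / 2) * eta1 `^ (3 / 2))) * mu `^ (- (1 / 2)) +
  40 `^ (1 / 5) * LG `^ (3 / 5) / ((1 - C) `^ (1 / 5) * eta1 `^ (6 / 5)) *
    mu `^ (- (3 / 5)).

(* [gap1] is psi_{mu1}(x1) - psi_{mu1}^star. *)
Definition ell_bound (C gamma eta1 LG LH W mu1 gap1 : R) (J : nat) (eps : R)
    : R :=
  W * J%:R / (C * gamma) * r_bound C eta1 LG LH (W^-1 * eps) + J%:R +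
  gap1 / (C * gamma * mu1) *
    (8 * LG `^ (2 / 3) / ((1 - C) `^ (2 / 3) * eta1 `^ (4 / 3)) *
       mu1 `^ (- (2 / 3)) + r_bound C eta1 LG LH mu1).

End Bounds.

(* Main.v *)
From mathcomp Require Import ring lra.
Require Import Defs.

(** The proof measures progress by the logarithmic barrier.

A nonterminal Newton step from [x] decreases the barrier by at least
[C * gamma * mu / step_bound mu] ([inner_decrease]). Consider the step that
backtracking rejected, or the full step if it was accepted. If the model
predicted a decrease below [mu / step_bound mu] along it, that step would be
short: the acceptance test on the Newton direction bounds its length, and the
rank-one terms of the Hessian of the barrier bound the relative change of each
constraint ([trial_step_short]). On a short step the Taylor expansions of the
objective and of the constraints are valid, since the segment stays feasible, and
the error of the model is at most the fraction [1 - C] of the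
predicted decrease ([short_step_model_error]). So Armijo's condition holds there,
the rejected step does not exist, and the step taken is the full one. For the
full step the Newton equation cancels the first-order part of the gradient of
the Lagrangian, so that the new primal-dual pair is approximately stationary
([short_step_SIP]) and the run would have returned. Hence the length of a run is
at most the initial barrier gap times [step_bound mu / (C * gamma * mu)]
([inner_run]).

At the starting point chosen after a run, adding up the gradient inequalities of
the convex problem bounds the duality gap ([lagrangian_gap]). At the Slater point
this is a quadratic inequality for [Num.sqrt (1 + norm1 y)], whose larger root is
[lambda]. Consequently both the suboptimality of the starting point and its
barrier gap are at most [W] times the new barrier parameter
([annealing_update_gap], [annealing_update_barrier_gap]): all runs but the first
have length at most [W / (C * gamma) * step_bound mu].

The barrier parameters decrease at least geometrically. Taking the first
starting point with [W * mu <= eps] yields the logarithmic bound on the number of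
outer iterations ([outer_iterations_le]). The parameters used before exceed
[eps / W], so the powers [mu `^ (- (2 / 3))] in the lengths of the runs are
dominated by a geometric series with largest term [(eps / W) `^ (- (2 / 3))]:
this is the leading term. The remaining part of each length is at most a multiple
of the value of [r_bound] at [eps / W], counted once per run
([newton_steps_le]). *)

Local Open Scope classical_set_scope.
Local Open Scope ring_scope.

(** * Euclidean geometry of row vectors *)

Section Euclidean.
Context {R : realType} {n : nat}.
Implicit Types (u v w : 'rV[R]_n) (c : R).

Lemma dotC u v : dot u v = dot v u.
Proof. by apply: eq_bigr => i _; rewrite mulrC. Qed.

Lemma dotDl u v w : dot (u + v) w = dot u w + dot v w.
Proof. by rewrite -big_split; apply: eq_bigr => i _; rewrite mxE mulrDl. Qed.

Lemma dotZl c u w : dot (c *: u) w = c * dot u w.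
Proof. by rewrite mulr_sumr; apply: eq_bigr => i _; rewrite mxE mulrA. Qed.

Lemma dotNl u w : dot (- u) w = - dot u w.
Proof. by rewrite -scaleN1r dotZl mulN1r. Qed.

Lemma dotBl u v w : dot (u - v) w = dot u w - dot v w.
Proof. by rewrite dotDl dotNl. Qed.

Lemma dotDr u v w : dot w (u + v) = dot w u + dot w v.
Proof. by rewrite !(dotC w) dotDl. Qed.

Lemma dotZr c u w : dot w (c *: u) = c * dot w u.
Proof. by rewrite !(dotC w) dotZl. Qed.

Lemma dotNr u w : dot w (- u) = - dot w u.
Proof. by rewrite !(dotC w) dotNl. Qed.

Lemma dotBr u v w : dot w (u - v) = dot w u - dot w v.
Proof. by rewrite dotDr dotNr. Qed.

Lemma dot0l u : dot 0 u = 0.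
Proof. by rewrite -(scale0r 0) dotZl mul0r. Qed.

Lemma dot0r u : dot u 0 = 0. Proof. by rewrite dotC dot0l. Qed.

Lemma dot_sumr m (F : 'I_m -> 'rV[R]_n) u :
  dot u (\sum_(i < m) F i) = \sum_(i < m) dot u (F i).
Proof.
by elim/big_rec2: _ => [|i x y _ <-]; rewrite ?dot0r ?dotDr.
Qed.

Lemma dot_sqr u : dot u u = norm2 u ^+ 2.
Proof.
rewrite sqr_sqrtr; last by apply: sumr_ge0 => i _; exact: sqr_ge0.
by apply: eq_bigr => i _; rewrite expr2.
Qed.

Lemma norm2_ge0 u : 0 <= norm2 u. Proof. exact: sqrtr_ge0. Qed.
Hint Resolve norm2_ge0 : core.

Lemma norm2Z c u : norm2 (c *: u) = `|c| * norm2 u.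
Proof.
apply/eqP; rewrite -(@eqrXn2 _ 2) ?mulr_ge0//; apply/eqP.
by rewrite exprMn -!dot_sqr dotZl dotZr mulrA -expr2 real_normK ?num_real.
Qed.

Lemma norm2_0 : norm2 (0 : 'rV[R]_n) = 0.
Proof. by rewrite -(scale0r 0) norm2Z normr0 mul0r. Qed.

Lemma norm2N u : norm2 (- u) = norm2 u.
Proof. by rewrite -scaleN1r norm2Z normrN1 mul1r. Qed.

Lemma norm2_eq0 u : norm2 u = 0 -> u = 0.
Proof.
move=> u0; have : dot u u = 0 by rewrite dot_sqr u0 expr0n.
move=> /eqP; rewrite psumr_eq0 => [/allP u00|i _]; last by rewrite -expr2 sqr_ge0.
apply/rowP => i; rewrite mxE; apply/eqP.
by have := u00 i (mem_index_enum _); rewrite mulf_eq0 orbb.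
Qed.

(** The discriminant argument, with the minimizing coefficient plugged in. *)
Lemma cauchy_schwarz u v : dot u v <= norm2 u * norm2 v.
Proof.
have [u0|u0] := eqVneq (norm2 u) 0.
  by rewrite (norm2_eq0 u0) dot0l mulr_ge0.
have [v0|v0] := eqVneq (norm2 v) 0.
  by rewrite (norm2_eq0 v0) dot0r mulr_ge0.
have up : 0 < norm2 u by rewrite lt0r u0 norm2_ge0.
have vp : 0 < norm2 v by rewrite lt0r v0 norm2_ge0.
have : 0 <= dot (norm2 v *: u - norm2 u *: v) (norm2 v *: u - norm2 u *: v).
  by rewrite dot_sqr sqr_ge0.
rewrite dotBl !dotBr !dotZl !dotZr !dot_sqr (dotC v u) => H.
have {}H : 0 <= (norm2 u * norm2 v) * (norm2 u * norm2 v - dot u v) by lra.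
by move: H; rewrite pmulr_rge0 ?mulr_gt0// subr_ge0.
Qed.

Lemma cauchy_schwarz_abs u v : `|dot u v| <= norm2 u * norm2 v.
Proof.
rewrite ler_norml cauchy_schwarz andbT lerNl -dotNl.
by rewrite (le_trans (cauchy_schwarz _ _))// norm2N.
Qed.

Lemma norm2D u v : norm2 (u + v) <= norm2 u + norm2 v.
Proof.
rewrite -(@ler_pXn2r _ 2) ?nnegrE ?addr_ge0// -dot_sqr dotDl !dotDr !dot_sqr.
by rewrite (dotC v u); have := cauchy_schwarz u v; lra.
Qed.

Lemma norm2_sum m (F : 'I_m -> 'rV[R]_n) :
  norm2 (\sum_(i < m) F i) <= \sum_(i < m) norm2 (F i).
Proof.
elim/big_rec2: _ => [|i x y _ h]; first by rewrite norm2_0.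
by rewrite (le_trans (norm2D _ _))// lerD2l.
Qed.

(** Testing against the vector itself turns bounds on all the linear
functionals of a vector into a bound on its norm. *)
Lemma norm2_le_dot u c : 0 <= c ->
  (forall v, dot u v <= c * norm2 v) -> norm2 u <= c.
Proof.
move=> c0 /(_ u); rewrite dot_sqr expr2.
have [->//|u0] := eqVneq (norm2 u) 0.
by rewrite ler_pM2r// lt0r u0 norm2_ge0.
Qed.

Lemma coord_le_norm2 u i : `|u 0 i| <= norm2 u.
Proof.
rewrite -sqrtr_sqr ler_sqrt; last by apply: sumr_ge0 => j _; exact: sqr_ge0.
by rewrite (bigD1 i)//= lerDl sumr_ge0// => j _; exact: sqr_ge0.
Qed.

Lemma norm1_ge0 u : 0 <= norm1 u.
Proof. by apply: sumr_ge0 => i _; exact: normr_ge0. Qed.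

Lemma opnorm2_has_ubound (A : 'M[R]_n) :
  has_ubound [set norm2 (w *m A) | w in [set w : 'rV[R]_n | norm2 w <= 1]].
Proof.
exists (\sum_i norm2 (row i A)) => _ /= [w w1 <-].
rewrite mulmx_sum_row (le_trans (norm2_sum _))//; apply: ler_sum => i _.
by rewrite norm2Z ler_piMl// (le_trans (coord_le_norm2 _ _)).
Qed.

Lemma norm2_mulmx_le w (A : 'M[R]_n) : norm2 (w *m A) <= opnorm2 A * norm2 w.
Proof.
have [w0|w0] := eqVneq (norm2 w) 0.
  by rewrite w0 (norm2_eq0 w0) mul0mx norm2_0 mulr0.
have wp : 0 < norm2 w by rewrite lt0r w0 norm2_ge0.
rewrite -ler_pdivrMr//; apply: (@le_trans _ _ (norm2 (((norm2 w)^-1 *: w) *m A))).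
  by rewrite -scalemxAl norm2Z ger0_norm ?invr_ge0// mulrC.
apply: (ub_le_sup (opnorm2_has_ubound A)); exists ((norm2 w)^-1 *: w) => //=.
by rewrite norm2Z ger0_norm ?invr_ge0// mulVf.
Qed.

End Euclidean.
#[local] Hint Extern 0 (is_true (@Order.le _ _ _ (norm2 _))) =>
  exact: norm2_ge0 : core.
#[local] Hint Extern 0 (is_true (@Order.le _ _ _ (norm1 _))) =>
  exact: norm1_ge0 : core.

(** * Taylor estimates along segments *)

Section Taylor_line.
Context {R : realType}.
Implicit Types phi psi : R -> R.

(** Both [psi + phi] and [psi - phi] are nondecreasing. Applied repeatedly with
monomials for [psi], this gives the Taylor estimates below without integrals. *)
Lemma le_increment_of_le_derive phi psi (dphi dpsi : R -> R) :
  (forall t : R, 0 <= t <= 1 -> is_derive t 1 phi (dphi t)) ->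
  (forall t : R, 0 <= t <= 1 -> is_derive t 1 psi (dpsi t)) ->
  (forall t : R, 0 <= t <= 1 -> `|dphi t| <= dpsi t) ->
  forall t : R, 0 <= t <= 1 -> `|phi t - phi 0| <= psi t - psi 0.
Proof.
move=> Dphi Dpsi dle t /andP[t0 t1].
have mono (g dg : R -> R) :
    (forall t : R, 0 <= t <= 1 -> is_derive t 1 g (dg t)) ->
    (forall t : R, 0 <= t <= 1 -> 0 <= dg t) -> g 0 <= g t.
  move=> Dg dg0; have oo_cc (x : R) : x \in `]0, 1[%R -> 0 <= x <= 1.
    by rewrite in_itv/= => /andP[x0 x1]; rewrite !ltW.
  apply: (@ger0_derive1_ndecr R g 0 1) => //.
  - by move=> x /oo_cc x01; have [] := Dg x x01.
  - by move=> x /oo_cc x01; have ? := Dg x x01; rewrite derive1E derive_val dg0.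
  - by apply: derivable_within_continuous => x; rewrite in_itv/= => /Dg[].
rewrite ler_norml; apply/andP; split.
- have : (psi + phi) 0 <= (psi + phi) t.
    apply: (mono _ (fun t => dpsi t + dphi t)) => x x01.
      by have ? := Dphi x x01; have ? := Dpsi x x01; exact: is_deriveD.
    by have := dle x x01; rewrite ler_norml => /andP[]; lra.
  by rewrite !fctE; lra.
- have : (psi - phi) 0 <= (psi - phi) t.
    apply: (mono _ (fun t => dpsi t - dphi t)) => x x01.
      by have ? := Dphi x x01; have ? := Dpsi x x01; exact: is_deriveB.
    by have := dle x x01; rewrite ler_norml => /andP[]; lra.
  by rewrite !fctE; lra.
Qed.

Let is_derive_monomial (K : R) m (t : R) :
  is_derive t 1 (fun t : R => K * t ^+ m.+1) (K * (m.+1%:R * t ^+ m)).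
Proof.
have -> : (fun t : R => K * t ^+ m.+1) = K \*: (id ^+ m.+1 : R -> R).
  by apply/funext => x; rewrite /= fctE.
apply: is_derive_eq; rewrite scaler1; congr (K * (_ * _)).
Qed.

Lemma taylor_le1 phi (dphi : R -> R) K :
  (forall t : R, is_derive t 1 phi (dphi t)) ->
  (forall t : R, 0 <= t <= 1 -> `|dphi t - dphi 0| <= K * t) ->
  forall t : R, 0 <= t <= 1 ->
    `|phi t - phi 0 - dphi 0 * t| <= K / 2 * t ^+ 2.
Proof.
move=> Dphi dle t t01.
have := @le_increment_of_le_derive (phi - dphi 0 \*: id)
  (fun t => K / 2 * t ^+ 2) (fun t => dphi t - dphi 0)
  (fun t => K * t).
move=> /(_ _ _ dle t t01); rewrite !fctE/=.
rewrite [in X in _ -> X](_ : K / 2 * t ^+ 2 = K / 2 * t ^+ 2 - K / 2 * 0 ^+ 2); last by ring.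
rewrite [in X in _ -> X](_ : phi t - phi 0 - dphi 0 * t =
  phi t - dphi 0 * t - (phi 0 - dphi 0 * 0)); last by ring.
apply.
- by move=> x _; apply: is_derive_eq; rewrite scaler1.
- move=> x _; apply: (is_derive_eq (is_derive_monomial _ 1 x)).
  by rewrite expr1; field.
Qed.

Lemma taylor_le2 phi (dphi ddphi : R -> R) K :
  (forall t : R, is_derive t 1 phi (dphi t)) ->
  (forall t : R, is_derive t 1 dphi (ddphi t)) ->
  (forall t : R, 0 <= t <= 1 -> `|ddphi t - ddphi 0| <= K * t) ->
  `|phi 1 - phi 0 - dphi 0 - 2^-1 * ddphi 0| <= K / 6.
Proof.
move=> Dphi Ddphi ddle.
have := @le_increment_of_le_derive
  (phi - dphi 0 \*: id - (fun t => ddphi 0 / 2 * t ^+ 2))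
  (fun t => K / 6 * t ^+ 3) (fun t => dphi t - dphi 0 - ddphi 0 * t)
  (fun t => K / 2 * t ^+ 2).
have t01 : 0 <= (1 : R) <= 1 by rewrite ler01 lexx.
move=> /(_ _ _ (taylor_le1 Ddphi ddle) 1 t01); rewrite !fctE/=.
rewrite [in X in _ -> X](_ : K / 6 = K / 6 * 1 ^+ 3 - K / 6 * 0 ^+ 3); last by ring.
rewrite [in X in _ -> X](_ : phi 1 - phi 0 - dphi 0 - 2^-1 * ddphi 0 =
  phi 1 - dphi 0 * 1 - ddphi 0 / 2 * 1 ^+ 2 -
  (phi 0 - dphi 0 * 0 - ddphi 0 / 2 * 0 ^+ 2)); last by ring.
apply.
- move=> x _; apply: (is_derive_eq (is_deriveB (is_deriveB (Dphi x)
    (is_deriveZ _ (is_derive_id x 1))) (is_derive_monomial _ 1 x))).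
  by rewrite expr1 scaler1; field.
- by move=> x _; apply: (is_derive_eq (is_derive_monomial _ 2 x)); field.
Qed.

(** Along the segment from 1 to 1 + u, the remainder has derivative
u^3 t^2 / (1 + t u), whose denominator is at least 1/2; hence it is at most
2/3 |u|^3. *)
Lemma ln1D_taylor2 (u : R) : `|u| <= 1 / 2 ->
  u - u ^+ 2 / 2 - `|u| ^+ 3 <= ln (1 + u).
Proof.
move=> u12; have [ul ur] : - (1 / 2) <= u /\ u <= 1 / 2.
  by move: u12; rewrite ler_norml => /andP[]; split; lra.
have pos (t : R) : 0 <= t <= 1 -> 1 / 2 <= 1 + t * u.
  by case/andP => t0 t1; nra.
have := @le_increment_of_le_derive
  (fun t => ln (1 + t * u) - t * u + t ^+ 2 * (u ^+ 2 / 2))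
  (fun t => 2 / 3 * `|u| ^+ 3 * t ^+ 3)
  (fun t => (1 + t * u)^-1 * u - u + t * u ^+ 2)
  (fun t => 2 * `|u| ^+ 3 * t ^+ 2).
move=> H; have {H} := H _ _ _ 1 _; rewrite ler01 lexx !mul0r addr0 ln1 !mul1r.
rewrite !expr1n !expr0n/= !(mulr0, mul0r, subr0, addr0, mul1r, mulr1) => H.
suff : `|ln (1 + u) - u + u ^+ 2 / 2| <= 2 / 3 * `|u| ^+ 3.
  have : 0 <= `|u| ^+ 3 by rewrite exprn_ge0.
  by rewrite ler_norml => ? /andP[]; lra.
apply: H => // t t01; have pt := pos t t01.
- have Dlin : is_derive t 1 (fun t : R => 1 + t * u) u.
    have -> : (fun t : R => 1 + t * u) = cst 1 + u \*: id.
      by apply/funext => s; rewrite !fctE mulrC.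
    by apply: is_derive_eq; rewrite scaler1 add0r.
  have Dln : is_derive t 1 (fun t : R => ln (1 + t * u)) ((1 + t * u)^-1 * u).
    by apply: (is_derive1_comp (is_derive1_ln _) Dlin); lra.
  have Dsq : is_derive t 1 (fun t : R => t ^+ 2 * (u ^+ 2 / 2)) (t * u ^+ 2).
    have -> : (fun t : R => t ^+ 2 * (u ^+ 2 / 2)) =
        (fun t => u ^+ 2 / 2 * t ^+ 2) by apply/funext => s; rewrite mulrC.
    by apply: (is_derive_eq (is_derive_monomial _ 1 t)); rewrite expr1; field.
  have -> : (fun t : R => ln (1 + t * u) - t * u + t ^+ 2 * (u ^+ 2 / 2)) =
      (fun t => ln (1 + t * u)) - u \*: id + (fun t => t ^+ 2 * (u ^+ 2 / 2)).
    by apply/funext => s; rewrite !fctE (mulrC s u).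
  by apply: is_derive_eq; rewrite scaler1.
- by apply: (is_derive_eq (is_derive_monomial _ 2 t)); field.
- have -> : (1 + t * u)^-1 * u - u + t * u ^+ 2 =
      u ^+ 3 * t ^+ 2 * (1 + t * u)^-1 by field; rewrite gt_eqF//; lra.
  rewrite normrM normrM normrX (ger0_norm (sqr_ge0 t)).
  rewrite [X in _ * X]ger0_norm; last by rewrite invr_ge0; lra.
  rewrite [leRHS](_ : _ = `|u| ^+ 3 * t ^+ 2 * 2); last by ring.
  rewrite ler_wpM2l//.
    by rewrite mulr_ge0 ?sqr_ge0 ?exprn_ge0.
  by rewrite invf_ple ?posrE; lra.
Qed.

End Taylor_line.

(** * Gradients and Hessians along lines *)

(** The product of a vector with the Hessian is locked: were it transparent,
unification would unfold it down to the limits defining the derivatives. *)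
Fact hessmul_key : unit. Proof. by []. Qed.

Definition hessmul {R : realType} {n} (g : 'rV[R]_n -> R) (x z : 'rV[R]_n) :
  'rV[R]_n := locked_with hessmul_key (z *m hess g x).

Section Gradient_hessian.
Context {R : realType} {n : nat}.
Implicit Types (g : 'rV[R]_n -> R) (x z : 'rV[R]_n).

Lemma gradE g x j : grad g x 0 j = 'D_(delta_mx 0 j) g x.
Proof. exact: mxE. Qed.

Lemma hessmulE g x z : hessmul g x z = z *m hess g x.
Proof. exact: unlock. Qed.

Lemma derive_hess g x z :
  differentiable (grad g) x -> 'D_z (grad g) x = hessmul g x z.
Proof. rewrite hessmulE; exact: deriveEjacobian. Qed.

Lemma modelE q f (a : 'rV[R]_n -> 'rV[R]_q) mu x z : model f a mu x z =
  dot (grad_psi f a mu x) z + 2^-1 * dot z (hessmul (log_barrier f a mu) x z).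
Proof. by rewrite hessmulE. Qed.

Lemma mulmx_hess_psi_shift q f (a : 'rV[R]_n -> 'rV[R]_q) mu x z delta :
  z *m (hess_psi f a mu x + delta%:M) =
  hessmul (log_barrier f a mu) x z + delta *: z.
Proof. by rewrite mulmxDr mul_mx_scalar hessmulE. Qed.

End Gradient_hessian.

Section Line_derivatives.
Context {R : realType} {n : nat}.
Implicit Types (g : 'rV[R]_n -> R) (x z v : 'rV[R]_n).

Lemma is_derive_line {W : normedModType R} (h : 'rV[R]_n -> W) x z (t : R) :
  differentiable h (x + t *: z) ->
  is_derive t 1 (fun t : R => h (x + t *: z)) ('D_z h (x + t *: z)).
Proof.
move=> dh.
have hz : differentiable (fun t : R => x + t *: z) t by [].
apply: DeriveDef; first exact/derivable1_diffP/differentiable_comp.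
rewrite deriveE; last exact: differentiable_comp.
rewrite diff_comp//= deriveE//; congr ('d _ _ _).
by rewrite diff_val add0r scale1r.
Qed.

Lemma derive_grad g x z : differentiable g x -> 'D_z g x = dot (grad g x) z.
Proof.
move=> dg; rewrite deriveE// {1}(row_sum_delta z) linear_sum/=.
by apply: eq_bigr => i _; rewrite linearZ/= gradE -deriveE// mulrC.
Qed.

Lemma is_derive_grad_line g x z (t : R) :
  (forall x, differentiable g x) ->
  is_derive t 1 (fun t : R => g (x + t *: z)) (dot (grad g (x + t *: z)) z).
Proof. by move=> dg; rewrite -derive_grad//; exact: is_derive_line. Qed.

Lemma is_derive_hess_line g x z v (t : R) :
  (forall x, differentiable (grad g) x) ->
  is_derive t 1 (fun t : R => dot (grad g (x + t *: z)) v)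
    (dot (hessmul g (x + t *: z) z) v).
Proof.
move=> dg.
have /(_ _) Dc i : is_derive t 1 (fun t : R => grad g (x + t *: z) 0 i)
    ((hessmul g (x + t *: z) z) 0 i).
  have [D E] := is_derive_line (dg (x + t *: z)).
  apply: DeriveDef; first exact: (derivable_mxP _ _ _).1.
  have := congr1 (fun r : 'rV[R]_n => r 0 i) (derive_mx D).
  rewrite E (derive_hess _ (dg _)) => ->.
  exact/esym/mxE.
have -> : (fun t : R => dot (grad g (x + t *: z)) v) =
    \sum_(i < n) (v 0 i \*: (fun t : R => grad g (x + t *: z) 0 i)).
  by apply/funext => s; rewrite fct_sumE; apply: eq_bigr => i _; rewrite mulrC.
apply: is_derive_eq; apply: eq_bigr => i _; exact: mulrC.
Qed.

End Line_derivatives.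

(** The derivatives are Lipschitz on a set only, so the expansions require the
whole segment from [x] to [x + z] to lie in it. *)
Section Lipschitz_taylor.
Context {R : realType} {n : nat}.
Variables (X : set 'rV[R]_n) (LG LH : R) (g : 'rV[R]_n -> R).
Hypotheses (smooth_g : thrice_differentiable g)
  (lip_g : lipschitz_derivatives X LG LH g).
Variables x z : 'rV[R]_n.
Hypothesis seg : forall t : R, 0 <= t <= 1 -> X (x + t *: z).

Let Xx : X x.
Proof. by have := @seg 0; rewrite scale0r addr0 lexx ler01; exact. Qed.

Let dist_seg (t : R) : 0 <= t <= 1 -> norm2 (x + t *: z - x) = t * norm2 z.
Proof. by case/andP => t0 _; rewrite addrAC subrr add0r norm2Z ger0_norm. Qed.

Let hess_seg (t : R) : 0 <= t <= 1 ->
  norm2 (hessmul g (x + t *: z) z - hessmul g x z) <= LH * norm2 z ^+ 2 * t.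
Proof.
move=> t01; rewrite !hessmulE -mulmxBr (le_trans (norm2_mulmx_le _ _))//.
have [_ /(ler_wpM2r (norm2_ge0 z)) h] := lip_g (seg t01) Xx.
by apply: (le_trans h); rewrite dist_seg// expr2; lra.
Qed.

Lemma lipschitz_taylor1 :
  `|g (x + z) - g x - dot (grad g x) z| <= LG / 2 * norm2 z ^+ 2.
Proof.
have [dg _ _] := smooth_g.
have := @taylor_le1 R (fun t => g (x + t *: z))
  (fun t => dot (grad g (x + t *: z)) z) (LG * norm2 z ^+ 2).
move=> /(_ (fun t => is_derive_grad_line x z t dg)) => /(_ _ 1).
rewrite !scale0r !addr0 !scale1r ler01 lexx mulr1 expr1n mulr1.
move=> H; rewrite mulrAC; apply: H => // t t01.
rewrite -dotBl (le_trans (cauchy_schwarz_abs _ _))//.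
have [/(ler_wpM2r (norm2_ge0 z)) h _] := lip_g (seg t01) Xx.
by apply: (le_trans h); rewrite dist_seg// expr2; lra.
Qed.

Lemma lipschitz_taylor_grad :
  norm2 (grad g (x + z) - grad g x - hessmul g x z) <= LH / 2 * norm2 z ^+ 2.
Proof.
have [_ ddg _] := smooth_g.
have LHz : 0 <= LH * norm2 z ^+ 2.
  have := hess_seg (t := 1); rewrite lexx ler01 mulr1 => /(_ isT).
  exact: le_trans (norm2_ge0 _).
apply: norm2_le_dot => [|v]; first by rewrite mulrAC divr_ge0.
have := @taylor_le1 R (fun t => dot (grad g (x + t *: z)) v)
  (fun t => dot (hessmul g (x + t *: z) z) v) (LH * norm2 z ^+ 2 * norm2 v).
move=> /(_ (fun t => is_derive_hess_line x z v t ddg)) => /(_ _ 1).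
rewrite !scale0r !addr0 !scale1r ler01 lexx mulr1 expr1n mulr1 -!dotBl => H.
apply: le_trans (ler_norm _) _.
rewrite [leRHS](_ : _ = LH * norm2 z ^+ 2 * norm2 v / 2); last by field.
apply: H => // t t01.
rewrite -dotBl (le_trans (cauchy_schwarz_abs _ _))//.
by rewrite (mulrAC _ (norm2 v)); exact: ler_wpM2r (norm2_ge0 v) _ _ (hess_seg t01).
Qed.

Lemma lipschitz_taylor2 :
  `|g (x + z) - g x - dot (grad g x) z - 2^-1 * dot z (hessmul g x z)|
    <= LH / 6 * norm2 z ^+ 3.
Proof.
have [dg ddg _] := smooth_g.
have Dhess (t : R) : is_derive t 1 (fun t : R => dot (grad g (x + t *: z)) z)
    (dot z (hessmul g (x + t *: z) z)).
  by rewrite (dotC z); exact: is_derive_hess_line.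
have := @taylor_le2 R (fun t => g (x + t *: z))
  (fun t => dot (grad g (x + t *: z)) z)
  (fun t => dot z (hessmul g (x + t *: z) z)) (LH * norm2 z ^+ 3).
move=> /(_ (fun t => is_derive_grad_line x z t dg) Dhess).
rewrite !scale0r !addr0 !scale1r (mulrAC LH 6^-1) => H; apply: H => t t01.
rewrite -dotBr (le_trans (cauchy_schwarz_abs _ _))//.
have -> : LH * norm2 z ^+ 3 * t = norm2 z * (LH * norm2 z ^+ 2 * t) by ring.
exact: ler_wpM2l (norm2_ge0 z) _ _ (hess_seg t01).
Qed.

End Lipschitz_taylor.

(** * Differentiable convex functions *)

Section Convex.
Context {R : realType} {n : nat}.
Implicit Types (g : 'rV[R]_n -> R) (x y z : 'rV[R]_n).

Lemma convex_function_seg g x z (t : R) : convex_function setT g ->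
  0 <= t <= 1 -> g (x + t *: z) <= (1 - t) * g x + t * g (x + z).
Proof.
move=> cg t01.
pose p := Itv01 (andP t01).1 (andP t01).2.
have -> : x + t *: z = conv p (x + z : convex_lmodType 'rV[R]_n) x.
  rewrite [RHS](_ : _ = t *: (x + z) + (1 - t) *: x)//.
  by apply/rowP => i; rewrite !mxE; ring.
by rewrite [leRHS]addrC; exact: (cg p (x + z) x (mem_setT _) (mem_setT _)).
Qed.

(** The difference quotients at [x] in the direction [z] decrease to the
directional derivative, and the quotient for the step 1 is the right-hand side. *)
Lemma convex_grad_le g x z : convex_function setT g -> differentiable g x ->
  dot (grad g x) z <= g (x + z) - g x.
Proof.
move=> cg dg; rewrite -derive_grad//.
have dgz := @diff_derivable _ _ _ g x z dg.
rewrite /derive (cvg_at_rightE _ _ dgz).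
apply: limr_le; first exact: cvgP (cvg_dnbhs_at_right dgz).
near=> t.
have t0 : 0 < t by [].
have t1 : t <= 1 by near: t; exact: nbhs_right_ltW.
rewrite /= ler_pdivrMl// (addrC (t *: z)).
by have := @convex_function_seg g x z t cg; rewrite (ltW t0) t1 => /(_ isT); lra.
Unshelve. all: by end_near. Qed.

(** The derivative is monotone along a line: add up the gradient inequalities
taken at both ends of a small step. *)
Lemma convex_hess_ge0 g x z : convex_function setT g ->
  (forall x, differentiable g x) -> (forall x, differentiable (grad g) x) ->
  0 <= dot z (hessmul g x z).
Proof.
move=> cg dg ddg.
have := is_derive_hess_line x z z 0 ddg.
rewrite scale0r addr0 dotC => -[D <-].
rewrite /derive (cvg_at_rightE _ _ D).
apply: limr_ge; first exact: cvgP (cvg_dnbhs_at_right D).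
near=> t.
have t0 : 0 < t by [].
rewrite /= scale0r !addr0 -[_ *: _]/(_ * _) [t%:A]mulr1 mulr_ge0 ?invr_ge0 ?(ltW t0)//.
have h1 := convex_grad_le (t *: z) cg (dg x).
have := convex_grad_le (- (t *: z)) cg (dg (x + t *: z)).
rewrite addrK dotNr => h2.
rewrite -(pmulr_rge0 _ t0) mulrBr -!dotZr; lra.
Unshelve. all: by end_near. Qed.

Lemma gradN g : (forall x, differentiable g x) ->
  grad (fun x => - g x) = - grad g.
Proof.
move=> dg; apply/funext => x; apply/rowP => j; rewrite [RHS]mxE !gradE.
exact: deriveN (@diff_derivable _ _ _ _ _ _ (dg x)).
Qed.

Lemma concave_grad_ge g x z : convex_function setT (fun x => - g x) ->
  (forall x, differentiable g x) -> g (x + z) - g x <= dot (grad g x) z.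
Proof.
move=> cg dg; have := convex_grad_le z cg (differentiableN (dg x)).
by rewrite gradN// dotNl; lra.
Qed.

Lemma concave_hess_le0 g x z : convex_function setT (fun x => - g x) ->
  (forall x, differentiable g x) -> (forall x, differentiable (grad g) x) ->
  dot z (hessmul g x z) <= 0.
Proof.
move=> cg dg ddg; have dN : grad (fun x => - g x) = - grad g by exact: gradN.
have ddN y : differentiable (grad (fun x => - g x)) y.
  by rewrite dN; exact: differentiableN.
have := convex_hess_ge0 x z cg (fun y => differentiableN (dg y)) ddN.
have -> : hessmul (fun x => - g x) x z = - (hessmul g x z).
  apply: (etrans (esym (derive_hess z (ddN x)))).
  rewrite dN; apply: (etrans (deriveN (@diff_derivable _ _ _ _ _ z (ddg x)))).
  by congr (- _); exact: derive_hess.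
by rewrite dotNr oppr_ge0.
Qed.

End Convex.

(** * Derivatives of the logarithmic barrier *)

Section Differentiability.
Context {R : realType}.

(** The formula for the gradient of the barrier is valid only where the
constraints are positive. To differentiate it once more at a strictly feasible
point, its differentiability is transported along the equality near the point. *)
Lemma near_eq_differentiable {V W : normedModType R} (g h : V -> W) (x : V) :
  (\forall y \near x, g y = h y) -> differentiable g x -> differentiable h x.
Proof.
move=> gh dg.
have E : h \o shift x = cst (h x) + 'd g x +o_ 0 id.
  apply/eqaddoP => _/posnumP[e]; have /eqaddoP/(_ e%:num) := diff_locally dg.
  move=> /(_ (gt0 e)) => gP.
  have gh0 : \forall y \near (0 : V), g (y + x) = h (y + x).
    by move: gh; rewrite (near_shift 0 x) subr0.
  near=> y.
  have : `|(g \o shift x - (cst (g x) + 'd g x)) y| <= e%:num * `|y|.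
    by near: y; exact: gP.
  rewrite !fctE/= (nbhs_singleton gh).
  suff -> : g (y + x) = h (y + x) by [].
  by near: y.
have dgc : continuous ('d g x) by exact: diff_continuous.
have dhE := diff_unique dgc E.
by apply/diff_locallyP; rewrite dhE; split.
Unshelve. all: by end_near. Qed.

Lemma differentiable_row {V : normedModType R} {m} (h : V -> 'rV[R]_m) (x : V) :
  (forall j, differentiable (fun y => h y 0 j) x) -> differentiable h x.
Proof.
move=> dh.
have -> : h = \sum_(j < m) (fun y => h y 0 j *: delta_mx 0 j).
  by apply/funext => y; rewrite fct_sumE; exact: row_sum_delta.
by apply: differentiable_sum => j; exact: differentiableZl.
Qed.

Lemma differentiable_row_coord {V : normedModType R} {m} (h : V -> 'rV[R]_m)
  (x : V) j : differentiable h x -> differentiable (fun y => h y 0 j) x.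
Proof.
move=> dh; apply: (@differentiable_comp _ _ _ _ h (fun M => M 0 j)) => //.
exact: differentiable_coord.
Qed.

Lemma is_derive_comp1 {V : normedModType R} (phi : R -> R) (g : V -> R)
    (x v : V) (dphi : R) :
  is_derive (g x) 1 phi dphi -> differentiable g x ->
  is_derive x v (phi \o g) (dphi * 'D_v g x).
Proof.
move=> [D E] dg; have dp : differentiable phi (g x) by exact/derivable1_diffP.
apply: DeriveDef; first exact/diff_derivable/differentiable_comp.
rewrite deriveE; last exact: differentiable_comp.
by rewrite diff_comp//= deriv1E// derive1E E deriveE// -[LHS]/(_ * _) mulrC.
Qed.

Lemma derive_grad_coord {n} (g : 'rV[R]_n -> R) x d j :
  differentiable (grad g) x ->
  is_derive x d (fun y => grad g y 0 j) ((hessmul g x d) 0 j).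
Proof.
move=> dg; have D := @diff_derivable _ _ _ _ _ d dg.
apply: DeriveDef; first exact: (derivable_mxP _ _ _).1 D 0 j.
have := congr1 (fun r : 'rV[R]_n => r 0 j) (derive_mx D).
rewrite (derive_hess _ dg) => ->.
exact/esym/mxE.
Qed.

End Differentiability.

Section Barrier.
Context {R : realType} {n q : nat}.
Variables (f : 'rV[R]_n -> R) (a : 'rV[R]_n -> 'rV[R]_q) (LG LH : R).
Hypothesis smooth : smooth_assumption f a LG LH.
Let ai i (x : 'rV[R]_n) : R := a x 0 i.
Implicit Types (x d : 'rV[R]_n) (mu : R).

Let df x : differentiable f x. Proof. by have [[[h _ _] _] _] := smooth. Qed.
Let ddf x : differentiable (grad f) x.
Proof. by have [[[_ h _] _] _] := smooth. Qed.
Let da i x : differentiable (ai i) x.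
Proof. by have [_ /(_ i)[[h _ _] _]] := smooth. Qed.
Let dda i x : differentiable (grad (ai i)) x.
Proof. by have [_ /(_ i)[[_ h _] _]] := smooth. Qed.

Lemma near_strictly_feasible x : strictly_feasible a x ->
  \forall y \near x, strictly_feasible a y.
Proof.
move=> ax.
apply: (@filter_forall _ _ (fun i y => 0 < ai i y) (nbhs x) (nbhs_filter x)) => i.
exact: (cvgr_gt _ (differentiable_continuous (da i x))) (ax i).
Qed.

Lemma grad_lagrangian x (y : 'rV[R]_q) :
  grad (lagrangian f a ^~ y) x = grad f x - \sum_i y 0 i *: grad (ai i) x.
Proof.
apply/rowP => j; rewrite !mxE summxE.
have -> : lagrangian f a ^~ y = f - \sum_(i < q) (y 0 i \*: ai i).
  by apply/funext => u; rewrite !fctE fct_sumE.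
have Df := derivableP (@diff_derivable _ _ _ _ _ (delta_mx 0 j) (df x)).
have Da i := derivableP (@diff_derivable _ _ _ _ _ (delta_mx 0 j) (da i x)).
rewrite derive_val; congr (_ - _); apply: eq_bigr => i _.
by rewrite !mxE.
Qed.

Lemma grad_log_barrier mu x : strictly_feasible a x ->
  grad (log_barrier f a mu) x =
    grad f x - \sum_i (mu / a x 0 i) *: grad (ai i) x.
Proof.
move=> ax; apply/rowP => j; rewrite !mxE summxE.
have -> : log_barrier f a mu =
    f - mu \*: \sum_(i < q) (@ln R \o ai i).
  by apply/funext => u; rewrite !fctE fct_sumE.
have Df := derivableP (@diff_derivable _ _ _ _ _ (delta_mx 0 j) (df x)).
have Da i : is_derive x (delta_mx 0 j) (@ln R \o ai i)
    ((a x 0 i)^-1 * 'D_(delta_mx 0 j) (ai i) x).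
  exact: is_derive_comp1 (is_derive1_ln (ax i)) (da i x).
rewrite derive_val; congr (_ - _); rewrite -[LHS]/(_ * _) mulr_sumr.
by apply: eq_bigr => i _; rewrite !mxE mulrA.
Qed.

Let G mu x := grad f x - \sum_i (mu / a x 0 i) *: grad (ai i) x.

Let G_coordE mu j : (fun y => G mu y 0 j) = (fun y => grad f y 0 j) -
    \sum_(i < q) ((fun y => mu / ai i y) * (fun y => grad (ai i) y 0 j)).
Proof.
apply/funext => y; rewrite !fctE fct_sumE /G mxE; congr (_ + _).
rewrite mxE summxE; congr (- _).
by apply: eq_bigr => i _; rewrite mxE.
Qed.

Let is_derive_inv mu i x d : strictly_feasible a x ->
  is_derive x d (fun y => mu / ai i y)
    (- (mu / a x 0 i ^+ 2 * dot (grad (ai i) x) d)).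
Proof.
move=> ax; have ai0 : ai i x != 0 by rewrite gt_eqF//; exact: ax.
have D := @diff_derivable _ _ _ _ _ d (da i x).
have DV := DeriveDef (derivableV ai0 D) (deriveV ai0 D).
rewrite -[fun y => _]/(mu \*: (fun y => (ai i y)^-1)).
apply: is_derive_eq; rewrite (derive_grad d (da i x)) -![LHS]/(_ * _).
by rewrite -[_ *: _]/(_ * _) mulNr mulrN mulrA.
Qed.

Let differentiable_G mu x : strictly_feasible a x -> differentiable (G mu) x.
Proof.
move=> ax; apply: differentiable_row => j; rewrite G_coordE.
apply: differentiableB; first exact: differentiable_row_coord.
apply: differentiable_sum => i; apply: differentiableM.
  apply: differentiableM => //; apply: differentiableV => //.
  by rewrite gt_eqF//; exact: ax.
exact: differentiable_row_coord.
Qed.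

Let near_grad_G mu x : strictly_feasible a x ->
  \forall y \near x, G mu y = grad (log_barrier f a mu) y.
Proof.
by move=> /near_strictly_feasible; apply: filterS => y ?; rewrite grad_log_barrier.
Qed.

Lemma hess_log_barrier mu x d : strictly_feasible a x ->
  hessmul (log_barrier f a mu) x d =
    hessmul f x d - \sum_i (mu / a x 0 i) *: (hessmul (ai i) x d)
    + \sum_i (mu / a x 0 i ^+ 2 * dot (grad (ai i) x) d) *: grad (ai i) x.
Proof.
move=> ax; have nG := near_grad_G mu ax; have dG := differentiable_G mu ax.
have dH : differentiable (grad (log_barrier f a mu)) x.
  exact: near_eq_differentiable nG dG.
apply: (etrans (esym (derive_hess d dH))).
apply: (etrans (esym (near_eq_derive d nG))).
have D := @diff_derivable _ _ _ _ _ d dG.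
apply/rowP => j.
rewrite (congr1 (fun r : 'rV[R]_n => r 0 j) (derive_mx D)) mxE G_coordE.
have Df := derive_grad_coord d j (ddf x).
have Da i := derive_grad_coord d j (dda i x).
have Di i := is_derive_inv mu i d ax.
apply: (etrans (@derive_val _ _ _ _ _ _ _ (is_deriveB Df
  (is_derive_sum (fun i => is_deriveM (Di i) (Da i)))))).
have coordE (u : 'rV[R]_n) (c e : 'I_q -> R) (v w : 'I_q -> 'rV[R]_n) :
    (u - \sum_i c i *: v i + \sum_i e i *: w i) 0 j =
    u 0 j - \sum_i (c i * v i 0 j - e i * w i 0 j).
  rewrite sumrB opprB !mxE !summxE addrAC -addrA; congr (_ + _).
  by congr (_ - _); apply: eq_bigr => i _; rewrite mxE.
apply: (etrans _ (esym (coordE _ _ _ _ _))); congr (_ - _).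
apply: eq_bigr => i _; congr (_ + _).
by rewrite -[LHS]/(_ * _) mulrN; congr (- _); exact: mulrC.
Qed.

Lemma mul_jacobian_constraints x d i : (d *m 'J a x) 0 i = dot (grad (ai i) x) d.
Proof.
have dax : differentiable a x by apply: differentiable_row => j; exact: da.
rewrite -deriveEjacobian//.
have D := @diff_derivable _ _ _ _ _ d dax.
rewrite (congr1 (fun r : 'rV[R]_q => r 0 i) (derive_mx D)) mxE.
exact: derive_grad (da i x).
Qed.

End Barrier.

(** * Feasibility along segments *)

Section Segment.
Context {R : realType} {n q : nat}.
Variable a : 'rV[R]_n -> 'rV[R]_q.
Hypothesis a_concave : forall i, convex_function setT (fun x => - a x 0 i).
Hypothesis a_diff : forall i x, differentiable (fun x => a x 0 i) x.
Implicit Types x z : 'rV[R]_n.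

Lemma concave_seg_ge i x z (t : R) : 0 <= t <= 1 ->
  (1 - t) * a x 0 i + t * a (x + z) 0 i <= a (x + t *: z) 0 i.
Proof. by move=> /(convex_function_seg x z (a_concave i)); lra. Qed.

Lemma feasible_segment x z (t : R) : feasible a x -> feasible a (x + z) ->
  0 <= t <= 1 -> feasible a (x + t *: z).
Proof.
move=> ax az t01 i; apply: le_trans (concave_seg_ge i x z t01).
by case/andP: t01 => t0 t1; rewrite addr_ge0 ?mulr_ge0 ?subr_ge0.
Qed.

(** If x + z violated a constraint, the first violation along the segment would
be at a root of a constraint, where all constraints still hold weakly. *)
Lemma strictly_feasible_endpoint x z : strictly_feasible a x ->
  (forall t, 0 <= t <= 1 -> feasible a (x + t *: z) ->
    strictly_feasible a (x + t *: z)) ->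
  strictly_feasible a (x + z).
Proof.
move=> ax self i0; rewrite ltNge; apply/negP => i0v.
have rootE i : exists t : R, a (x + z) 0 i <= 0 ->
    0 <= t <= 1 /\ a (x + t *: z) 0 i = 0.
  have [iv|] := boolP (a (x + z) 0 i <= 0); last by exists 0.
  have cont : {within `[0, 1], continuous (fun t : R => a (x + t *: z) 0 i)}.
    apply: derivable_within_continuous => t _.
    by have [] := is_derive_line (a_diff i (x + t *: z)).
  have := @IVT R (fun t : R => a (x + t *: z) 0 i) 0 1 0 ler01 cont.
  rewrite scale0r addr0 scale1r min_r ?max_l ?(le_trans iv) ?(ltW (ax i))//.
  by move=> /(_ isT)[t]; rewrite in_itv/= => t01 ?; exists t.
have [tau tauP] := choice rootE.
(* At the least root, a violated constraint has its own root later and is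
   nonnegative before it by concavity; the other constraints are nonnegative at
   both ends. *)
case: (@Order.TotalTheory.arg_minP _ _ _ i0 (fun i => a (x + z) 0 i <= 0) tau i0v) => i iv imin.
have [t01 ti] := tauP i iv.
have ft : feasible a (x + tau i *: z).
  move=> j; have [jv|jv] := boolP (a (x + z) 0 j <= 0).
    have [/andP[tj0 tj1] tj] := tauP j jv; have ij := imin j jv.
    have [tj00|tj00] := eqVneq (tau j) 0.
      have -> : tau i = 0 by case/andP: t01 => t0 _; apply/eqP; rewrite eq_le t0 andbT -tj00.
      by rewrite scale0r addr0 ltW//; exact: ax.
    have tjp : 0 < tau j by rewrite lt0r tj00.
    have := @concave_seg_ge j x (tau j *: z) (tau i / tau j).
    rewrite scalerA divfK// tj mulr0 addr0.
    case/andP: t01 => t0 t1; rewrite divr_ge0//= ler_pdivrMr// mul1r ij => /(_ isT).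
    apply: le_trans; rewrite mulr_ge0 ?(ltW (ax j))// subr_ge0.
    by rewrite ler_pdivrMr// mul1r.
  apply: le_trans (concave_seg_ge j x z t01).
  case/andP: t01 => t0 t1; rewrite -ltNge in jv.
  by rewrite addr_ge0 ?mulr_ge0 ?subr_ge0// ltW//; exact: ax.
by have := self _ t01 ft i; rewrite ti ltxx.
Qed.

End Segment.

(** * One regularized Newton step *)

Section Log_term.
Context {R : realType}.

(** One constraint changes by the factor [1 + (w + r)], with [w] its relative
slope and [r] the error of its linearization; the left-hand side is what the
model misses of the logarithm. The individual bound [rhoi] of the error is kept
apart from the uniform bound [rho] because the errors of all the constraints
together are also at most [rho]. *)
Lemma log_term_le (w r th rho rhoi : R) : `|w| <= th -> `|r| <= rhoi ->
  rhoi <= rho -> th <= 1 / 8 -> rho <= 1 / 16 ->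
  - ln (1 + (w + r)) + w + r - w ^+ 2 / 2 <=
    th * rhoi + rho * rhoi / 2 + (th + rho) * (2 * w ^+ 2 + 2 * (rho * rhoi)).
Proof.
move=> wth rrho rhoi_le th8 rho16.
have ri0 : 0 <= rhoi := le_trans (normr_ge0 r) rrho.
have th0 : 0 <= th := le_trans (normr_ge0 w) wth.
have u_le : `|w + r| <= th + rho by rewrite (le_trans (ler_normD _ _)) ?lerD// (le_trans rrho).
have := @ln1D_taylor2 R (w + r).
have -> : `|w + r| <= 1 / 2 by rewrite (le_trans u_le)//; lra.
move=> /(_ isT) Hln.
have wr : w * r <= th * rhoi.
  by rewrite (le_trans (ler_norm _))// normrM ler_pM.
have rr : r ^+ 2 <= rho * rhoi.
  rewrite -real_normK ?num_real// expr2 ler_pM//.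
  exact: le_trans rrho rhoi_le.
have u3 : `|w + r| ^+ 3 <= (th + rho) * (2 * w ^+ 2 + 2 * (rho * rhoi)).
  rewrite exprS real_normK ?num_real// ler_pM ?sqr_ge0//.
  have : 0 <= (w - r) ^+ 2 by exact: sqr_ge0.
  by move: rr; rewrite !expr2; lra.
by move: Hln u3 wr rr; rewrite !expr2; lra.
Qed.

End Log_term.

Section Step.
Context {R : realType} {n q : nat}.
Variables (f : 'rV[R]_n -> R) (a : 'rV[R]_n -> 'rV[R]_q) (LG LH : R).
Hypothesis f_convex : convex_function setT f.
Hypothesis a_concave : forall i, convex_function setT (fun x => - a x 0 i).
Hypothesis smooth : smooth_assumption f a LG LH.
Hypotheses (LG_gt0 : 0 < LG) (LH_gt0 : 0 < LH).
Let ai i (x : 'rV[R]_n) : R := a x 0 i.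

Let da i x : differentiable (ai i) x.
Proof. by have [_ /(_ i)[[h _ _] _]] := smooth. Qed.

Variables (mu : R) (x : 'rV[R]_n).
Hypotheses (mu_gt0 : 0 < mu) (ax : strictly_feasible a x).
Implicit Types (z d : 'rV[R]_n).

Let Y := norm1 (dual a mu x).

(** The relative first-order change of constraint [i] along [z]. *)
Definition slope z i : R := dot (grad (ai i) x) z / a x 0 i.

Lemma dualE i : dual a mu x 0 i = mu / a x 0 i.
Proof. by rewrite mxE. Qed.

Lemma dual_gt0 i : 0 < dual a mu x 0 i.
Proof. by rewrite dualE divr_gt0. Qed.

Lemma norm1_dual : norm1 (dual a mu x) = \sum_i mu / a x 0 i.
Proof. by apply: eq_bigr => i _; rewrite ger0_norm dualE// divr_ge0 ?ltW. Qed.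

Lemma dual_le_norm1 i : mu / a x 0 i <= Y.
Proof.
rewrite /Y norm1_dual (bigD1 i)//= lerDl sumr_ge0// => j _.
by rewrite divr_ge0 ?ltW.
Qed.

Lemma grad_mul_slope z i : dot (grad (ai i) x) z = slope z i * a x 0 i.
Proof. by rewrite divfK// gt_eqF. Qed.

Lemma grad_psi_dot z :
  dot (grad_psi f a mu x) z = dot (grad f x) z - mu * \sum_i slope z i.
Proof.
rewrite /grad_psi (grad_log_barrier smooth)// dotBl; congr (_ - _).
rewrite dotC dot_sumr mulr_sumr; apply: eq_bigr => i _.
by rewrite dotZr dotC grad_mul_slope; field; rewrite gt_eqF.
Qed.

Lemma hess_psi_dot z : dot z (hessmul (log_barrier f a mu) x z) =
  dot z (hessmul f x z) - \sum_i mu / a x 0 i * dot z (hessmul (ai i) x z)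
  + mu * \sum_i slope z i ^+ 2.
Proof.
rewrite (hess_log_barrier smooth)// dotDr dotBr !dot_sumr mulr_sumr.
congr (_ - _ + _); apply: eq_bigr => i _; rewrite dotZr//.
by rewrite (dotC z) grad_mul_slope; field; rewrite gt_eqF.
Qed.

(** By convexity the Hessians of the objective and of the constraints contribute
nonnegatively; what remains are the rank-one terms of the logarithms. *)
Lemma hess_psi_ge z : mu * \sum_i slope z i ^+ 2 <= dot z (hessmul (log_barrier f a mu) x z).
Proof.
have [[[df ddf _] _] sa] := smooth.
rewrite hess_psi_dot lerDr subr_ge0; apply: (@le_trans _ _ 0).
  apply: sumr_le0 => i _; have [[dai ddai _] _] := sa i.
  have yi : 0 <= mu / a x 0 i by rewrite divr_ge0 ?ltW.
  exact: mulr_ge0_le0 yi (concave_hess_le0 _ _ (a_concave i) dai ddai).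
exact: convex_hess_ge0.
Qed.

(** A short step, described by [th], which bounds the slopes of the constraints,
and by [b], which bounds the Euclidean length weighted by the
multipliers. In the application [th ^+ 2 / 2] is the decrease predicted by the
model divided by [mu], and [kp] is [1 - C]. *)
Section Short_step.
Variables (z : 'rV[R]_n) (kp eta1 th b : R).
Hypotheses (kp_ge0 : 0 <= kp) (kp_le1 : kp <= 1) (eta1_gt0 : 0 < eta1)
  (th_ge0 : 0 <= th) (b_ge0 : 0 <= b) (b_th : eta1 * b = th ^+ 2 / 2).
Hypotheses (z_le : norm2 z ^+ 2 * (1 + Y) <= b ^+ 2)
  (slope_le : \sum_i slope z i ^+ 2 <= th ^+ 2).
Hypotheses (th_le1 : th <= 1 / 8) (th_le2 : th <= kp / 80)
  (LG_le1 : 8 * LG * b ^+ 2 <= mu) (LG_le2 : LG * b ^+ 2 <= kp * th * mu / 32)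
  (LH_le : LH * b ^+ 2 <= kp * eta1 * mu).

Let Y_ge0 : 0 <= Y. Proof. exact: norm1_ge0. Qed.

Let slope_abs i : `|slope z i| <= th.
Proof.
rewrite -(@ler_pXn2r _ 2) ?nnegrE// real_normK ?num_real//.
apply: le_trans slope_le; rewrite (bigD1 i)//= lerDl sumr_ge0// => j _.
exact: sqr_ge0.
Qed.

Let norm2_z_le : norm2 z <= b.
Proof.
have : norm2 z ^+ 2 <= b ^+ 2.
  by apply: le_trans z_le; rewrite ler_peMr ?sqr_ge0// lerDl.
by rewrite ler_pXn2r ?nnegrE.
Qed.

Let dual_z_le i : mu / a x 0 i * norm2 z ^+ 2 <= b ^+ 2.
Proof.
apply: le_trans z_le; rewrite mulrC ler_wpM2l ?sqr_ge0//.
by rewrite (le_trans (dual_le_norm1 i)) ?lerDr.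
Qed.

Let LG_z_le i : LG * norm2 z ^+ 2 <= a x 0 i / 8.
Proof.
have a0 := ax i; have := dual_z_le i.
rewrite mulrAC ler_pdivrMr// => /(ler_wpM2l (ltW LG_gt0)) h.
have h2 := ler_wpM2r (ltW a0) LG_le1.
by rewrite -(ler_pM2l mu_gt0); lra.
Qed.

(** As long as the segment up to [x + t *: z] is feasible, the Taylor estimate
holds on it, and it keeps each constraint above 13/16 of its value at [x]: 1/8 is
lost through the slope and 1/16 through the curvature. *)
Lemma short_step_feasible : strictly_feasible a (x + z).
Proof.
have axw : feasible a x by move=> i; exact: ltW.
apply: (strictly_feasible_endpoint a_concave da ax) => t t01 ft i.
have seg (s : R) : 0 <= s <= 1 -> feasible a (x + s *: (t *: z)).
  exact: feasible_segment.
have [_ /(_ i)[sai lai]] := smooth.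
have := lipschitz_taylor1 sai lai seg.
have [t0 t1] := andP t01.
rewrite dotZr grad_mul_slope norm2Z (ger0_norm t0).
have := slope_abs i; have := LG_z_le i.
have a0 := ax i; rewrite exprMn !ler_norml => hL /andP[w1 w2] /andP[h _].
have h1 : t ^+ 2 * (LG * norm2 z ^+ 2) <= a x 0 i / 8.
  apply: le_trans hL; rewrite ler_piMl ?expr_le1//.
  by rewrite mulr_ge0 ?sqr_ge0 ?ltW.
have h2 : - (a x 0 i / 8) <= t * (slope z i * a x 0 i).
  have th8 := th_le1; have : - (1 / 8) <= t * slope z i by nra.
  by move/(ler_wpM2r (ltW a0)); lra.
by move: h; lra.
Qed.

Lemma short_step_segment (s : R) : 0 <= s <= 1 -> feasible a (x + s *: z).
Proof.
by apply: feasible_segment => // i; apply: ltW; [exact: ax|exact: short_step_feasible].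
Qed.

(** The relative error of the linearization of constraint [i]. *)
Definition lin_error i : R := a (x + z) 0 i / a x 0 i - 1 - slope z i.

Lemma constraint_growth i : a (x + z) 0 i = a x 0 i * (1 + (slope z i + lin_error i)).
Proof. by rewrite /lin_error; field; rewrite gt_eqF. Qed.

Let rhoi i := LG * norm2 z ^+ 2 / (2 * a x 0 i).
Let rho := LG * b ^+ 2 / (2 * mu).

Let lin_error_le i : `|lin_error i| <= rhoi i.
Proof.
have [_ /(_ i)[sai lai]] := smooth.
have := lipschitz_taylor1 sai lai short_step_segment.
rewrite grad_mul_slope.
have -> : a (x + z) 0 i - a x 0 i - slope z i * a x 0 i = lin_error i * a x 0 i.
  by rewrite constraint_growth; ring.
rewrite normrM (gtr0_norm (ax i)) -ler_pdivlMr//.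
by move/le_trans; apply; rewrite /rhoi le_eqVlt; apply/orP; left; apply/eqP; field; rewrite gt_eqF.
Qed.

Let rhoi_le i : rhoi i <= rho.
Proof.
have -> : rhoi i = LG * (mu / a x 0 i * norm2 z ^+ 2) / (2 * mu).
  by rewrite /rhoi; field; rewrite !gt_eqF.
by rewrite ler_wpM2r ?invr_ge0 ?mulr_ge0 ?(ltW mu_gt0)// ler_wpM2l// ltW.
Qed.

Let rho_le1 : rho <= 1 / 16.
Proof.
have LGb := LG_le1; have mu0 := mu_gt0.
by rewrite /rho ler_pdivrMr ?mulr_gt0//; lra.
Qed.

Let rho_le2 : rho <= kp * th / 64.
Proof.
have LGb := LG_le2; have mu0 := mu_gt0.
by rewrite /rho ler_pdivrMr ?mulr_gt0//; lra.
Qed.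

Let rho_ge0 : 0 <= rho.
Proof. by rewrite /rho divr_ge0// mulr_ge0 ?sqr_ge0// ltW. Qed.

(* The weights mu / a_i add up to the norm of the multipliers, so the sum of the
   errors obeys the same bound as each of them. *)
Let sum_rhoi : \sum_i rhoi i <= rho.
Proof.
have -> : \sum_i rhoi i = LG * (norm2 z ^+ 2 * Y) / (2 * mu).
  rewrite /Y norm1_dual !mulr_sumr mulr_suml; apply: eq_bigr => i _.
  by rewrite /rhoi; field; rewrite !gt_eqF.
rewrite ler_wpM2r ?invr_ge0 ?mulr_ge0 ?(ltW mu_gt0)// ler_wpM2l ?(ltW LG_gt0)//.
by apply: le_trans z_le; rewrite ler_wpM2l ?sqr_ge0 ?lerDr.
Qed.

(** With [w] the slope and [r] the linearization error, the next product is [mu]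
times (1 - w) (1 + w + r), in which the first-order terms in [w] cancel. *)
Lemma short_step_complementarity i :
  `|dual_next a mu x z 0 i * a (x + z) 0 i - mu| <= mu / 2.
Proof.
rewrite mxE (mul_jacobian_constraints smooth) grad_mul_slope dualE constraint_growth.
have -> : (mu / a x 0 i - mu / a x 0 i / a x 0 i * (slope z i * a x 0 i)) *
    (a x 0 i * (1 + (slope z i + lin_error i))) - mu =
    mu * (lin_error i - slope z i ^+ 2 - slope z i * lin_error i).
  by field; rewrite gt_eqF.
rewrite normrM gtr0_norm// mulrC [leRHS]mulrC ler_wpM2r ?(ltW mu_gt0)//.
have gl : `|lin_error i| <= 1 / 16.
  exact: le_trans (le_trans (lin_error_le i) (rhoi_le i)) rho_le1.
have sl : `|slope z i| <= 1 / 8 by rewrite (le_trans (slope_abs i)).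
move: gl sl; rewrite !ler_norml => /andP[g1 g2] /andP[s1 s2].
by apply/andP; split; nra.
Qed.

(** The factor 7/8 reappears under the square root in the condition relating
[eta1] and [eta2]: the stationarity tolerance is measured with the new
multipliers. *)
Lemma short_step_dual_next i : 7 / 8 * dual a mu x 0 i <= dual_next a mu x z 0 i.
Proof.
rewrite [leRHS]mxE (mul_jacobian_constraints smooth) grad_mul_slope.
have -> : dual a mu x 0 i - dual a mu x 0 i / a x 0 i * (slope z i * a x 0 i) =
    (1 - slope z i) * dual a mu x 0 i by field; rewrite gt_eqF.
rewrite ler_wpM2r ?(ltW (dual_gt0 i))//.
by have := le_trans (slope_abs i) th_le1; rewrite ler_norml => /andP[_]; lra.
Qed.

(** Two errors add up. The third-order Taylor error of the objective and of the
constraints, the latter weighted by the multipliers, is cubic in the length of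
[z]; with [LH_le] it takes 1/12 of [kp * mu * th ^+ 2]. The error of expanding
the logarithms is estimated term by term by [log_term_le] and takes 5/12. *)
Lemma short_step_model_error :
  log_barrier f a mu (x + z) - log_barrier f a mu x - model f a mu x z <=
    kp * mu * (th ^+ 2 / 2).
Proof.
have [[sf lf] sa] := smooth.
pose c i := dot z (hessmul (ai i) x z).
have mE : model f a mu x z = dot (grad f x) z + 2^-1 * dot z (hessmul f x z)
    - \sum_i (mu * slope z i + 2^-1 * (mu / a x 0 i) * c i - mu * slope z i ^+ 2 / 2).
  apply: (etrans (modelE _ _ _ _ _)).
  apply: (etrans (congr2 (fun u v => u + 2^-1 * v) (grad_psi_dot z) (hess_psi_dot z))).
  have -> : \sum_i (mu * slope z i + 2^-1 * (mu / a x 0 i) * c i -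
      mu * slope z i ^+ 2 / 2) = mu * \sum_i slope z i +
      2^-1 * \sum_i mu / a x 0 i * c i - 2^-1 * (mu * \sum_i slope z i ^+ 2).
    rewrite !mulr_sumr -big_split -sumrB; apply: eq_bigr => i _/=; ring.
  by ring.
have lnE : log_barrier f a mu (x + z) - log_barrier f a mu x =
    f (x + z) - f x - \sum_i mu * ln (1 + (slope z i + lin_error i)).
  have -> : \sum_i mu * ln (1 + (slope z i + lin_error i)) =
      mu * \sum_i ln (a (x + z) 0 i) - mu * \sum_i ln (a x 0 i).
    rewrite !mulr_sumr -sumrB; apply: eq_bigr => i _.
    rewrite -mulrBr constraint_growth lnM ?posrE ?ax//.
      by congr (_ * _); ring.
    by have := short_step_feasible i; rewrite constraint_growth pmulr_rgt0//; exact: ax.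
  by rewrite /log_barrier; ring.
pose B i := mu / a x 0 i * (LH / 6 * norm2 z ^+ 3) + mu *
  (th * rhoi i + rho * rhoi i / 2 +
    (th + rho) * (2 * slope z i ^+ 2 + 2 * (rho * rhoi i))).
have termP i : - (mu * ln (1 + (slope z i + lin_error i))) +
    (mu * slope z i + 2^-1 * (mu / a x 0 i) * c i - mu * slope z i ^+ 2 / 2) <= B i.
  have [sai lai] := sa i.
  have := lipschitz_taylor2 sai lai short_step_segment.
  rewrite grad_mul_slope constraint_growth -/(ai i) -/(c i).
  rewrite ler_norml => /andP[+ _] => /(ler_wpM2l (ltW (dual_gt0 i))).
  rewrite dualE => hA.
  have hB := log_term_le (slope_abs i) (lin_error_le i) (rhoi_le i) th_le1 rho_le1.
  have {}hB := ler_wpM2l (ltW mu_gt0) hB.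
  have E : mu / a x 0 i * (a x 0 i * (1 + (slope z i + lin_error i)) - a x 0 i -
      slope z i * a x 0 i - 2^-1 * c i) =
      mu * lin_error i - 2^-1 * (mu / a x 0 i) * c i.
    by field; rewrite gt_eqF.
  move: hA; rewrite E /B; lra.
have sumP : f (x + z) - f x - \sum_i mu * ln (1 + (slope z i + lin_error i)) -
    (dot (grad f x) z + 2^-1 * dot z (hessmul f x z)
    - \sum_i (mu * slope z i + 2^-1 * (mu / a x 0 i) * c i - mu * slope z i ^+ 2 / 2))
    <= LH / 6 * norm2 z ^+ 3 + \sum_i B i.
  have := ler_sum (index_enum 'I_q) (P := xpredT) (fun i _ => termP i).
  rewrite [leLHS]big_split/= sumrN => hS.
  have := lipschitz_taylor2 sf lf short_step_segment.
  by rewrite ler_norml => /andP[_]; lra.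
rewrite lnE mE; apply: (le_trans sumP).
have -> : \sum_i B i = Y * (LH / 6 * norm2 z ^+ 3) + mu *
  (th * (\sum_i rhoi i) + rho * (\sum_i rhoi i) / 2 +
    (th + rho) * (2 * \sum_i slope z i ^+ 2 + 2 * (rho * \sum_i rhoi i))).
  rewrite big_split/= -mulr_suml -norm1_dual; congr (_ + _).
  rewrite !(mulrDr, mulr_sumr, mulr_suml) -!big_split/=.
  by apply: eq_bigr => i _; ring.
have h3 : LH / 6 * norm2 z ^+ 3 + Y * (LH / 6 * norm2 z ^+ 3) <= kp * mu * th ^+ 2 / 12.
  have zb : norm2 z <= b := norm2_z_le.
  have -> : LH / 6 * norm2 z ^+ 3 + Y * (LH / 6 * norm2 z ^+ 3) =
      LH / 6 * (norm2 z ^+ 2 * (1 + Y) * norm2 z) by ring.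
  have zb3 : norm2 z ^+ 2 * (1 + Y) * norm2 z <= b ^+ 2 * b.
    by apply: ler_pM => //; rewrite mulr_ge0 ?sqr_ge0 ?addr_ge0.
  have LH60 : 0 <= LH / 6 by rewrite divr_ge0// ltW.
  have := ler_wpM2l LH60 zb3; have := ler_wpM2r b_ge0 LH_le.
  have -> : kp * eta1 * mu * b = kp * mu * (eta1 * b) by ring.
  rewrite b_th; lra.
have th2 := slope_le.
set S := \sum_i slope z i ^+ 2 in th2 *; set T := \sum_i rhoi i.
have TP : T <= rho by exact: sum_rhoi.
have h4 : th * T + rho * T / 2 + (th + rho) * (2 * S + 2 * (rho * T)) <=
    5 / 12 * kp * th ^+ 2.
  have r1 := rho_le1; have r2 := rho_le2; have r0 := rho_ge0.
  have t0 := th_ge0; have k1 := kp_le1; have k0 := kp_ge0.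
  have t2 := th_le2.
  have rT : rho * T <= rho ^+ 2 by rewrite expr2 ler_wpM2l.
  have tT : th * T <= th * rho by rewrite ler_wpM2l.
  have trp : 0 <= th + rho by rewrite addr_ge0.
  have : (th + rho) * (2 * S + 2 * (rho * T)) <= (th + rho) * (2 * th ^+ 2 + 2 * rho ^+ 2).
    by rewrite ler_wpM2l//; lra.
  have rt : rho <= th / 64.
    by apply: (le_trans r2); rewrite ler_wpM2r// ler_piMl.
  have r2t : rho ^+ 2 <= th ^+ 2 / 4096.
    have : rho ^+ 2 <= (th / 64) ^+ 2 by rewrite ler_pXn2r ?nnegrE// divr_ge0.
    by rewrite !expr2; lra.
  have thr : th * rho <= kp * th ^+ 2 / 64.
    by have := ler_wpM2l t0 r2; rewrite expr2; lra.
  have r2k : rho ^+ 2 <= kp * th ^+ 2 / 64.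
    apply: le_trans thr; rewrite expr2 ler_wpM2r//; lra.
  have th3 : th * th ^+ 2 <= kp / 80 * th ^+ 2 by rewrite ler_wpM2r ?sqr_ge0.
  have : (th + rho) * (2 * th ^+ 2 + 2 * rho ^+ 2) <=
      (th + th / 64) * (2 * th ^+ 2 + 2 * (th ^+ 2 / 4096)).
    apply: ler_pM => //; last by lra.
      by have := sqr_ge0 th; have := sqr_ge0 rho; lra.
    by rewrite lerD2l.
  have := mulr_ge0 k0 (sqr_ge0 th); lra.
have := ler_wpM2l (ltW mu_gt0) h4; lra.
Qed.

Let sqrt_Y_ge1 : 1 <= Num.sqrt (1 + Y).
Proof. by rewrite -[leLHS]sqrtr1 ler_sqrt ?lerDl// addr_ge0. Qed.

Let norm2_z_sqrt : norm2 z * Num.sqrt (1 + Y) <= b.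
Proof.
have : (norm2 z * Num.sqrt (1 + Y)) ^+ 2 <= b ^+ 2.
  by rewrite exprMn (@sqr_sqrtr _ (1 + Y)) ?addr_ge0.
by rewrite ler_pXn2r ?nnegrE// mulr_ge0.
Qed.

Let LG_b_th : LG * b * th <= kp * eta1 * mu / 16.
Proof.
have [b0|b0] := eqVneq b 0.
  by rewrite b0 mulr0 mul0r divr_ge0// !mulr_ge0// ltW.
have bp : 0 < b by rewrite lt0r b0.
rewrite -(ler_pM2r bp).
have -> : kp * eta1 * mu / 16 * b = kp * mu * (eta1 * b) / 16 by ring.
by rewrite b_th; have := ler_wpM2r th_ge0 LG_le2; rewrite !expr2; lra.
Qed.

(** By the Newton equation the first-order terms cancel, up to the
regularization; what remains is the curvature of the gradients, plus the product
of the multiplier step and the change of the constraint gradients. *)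
Lemma short_step_stationarity delta :
  hessmul (log_barrier f a mu) x z + delta *: z = - grad_psi f a mu x ->
  norm2 (grad (lagrangian f a ^~ (dual_next a mu x z)) (x + z) + delta *: z) <=
    5 / 8 * kp * eta1 * (mu * Num.sqrt (1 + Y)).
Proof.
move=> newton; have [[sf lf] sa] := smooth.
have xf : feasible a x by move=> i; exact: ltW.
have xzf : feasible a (x + z) by move=> i; exact/ltW/short_step_feasible.
pose y i := mu / a x 0 i; pose w i := slope z i.
have dz : delta *: z = - (grad f x - \sum_i y i *: grad (ai i) x) -
    (hessmul f x z - \sum_i y i *: hessmul (ai i) x z +
     \sum_i (y i * w i) *: grad (ai i) x).
  rewrite -(grad_log_barrier smooth mu ax) -[grad _ _]/(grad_psi f a mu x) -newton.
  rewrite addrAC -[LHS]add0r; congr (_ + _).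
  rewrite (hess_log_barrier smooth mu z ax).
  have -> : \sum_i (mu / a x 0 i ^+ 2 * dot (grad (ai i) x) z) *: grad (ai i) x =
      \sum_i (y i * w i) *: grad (ai i) x.
    apply: eq_bigr => i _; congr (_ *: _); rewrite grad_mul_slope /y /w.
    by field; rewrite gt_eqF.
  by rewrite subrr.
have dual_nextE i : dual_next a mu x z 0 i = y i - y i * w i.
  rewrite mxE (mul_jacobian_constraints smooth) grad_mul_slope dualE /y /w.
  by field; rewrite gt_eqF.
pose g' i := grad (ai i) (x + z); pose g i := grad (ai i) x.
pose h i := hessmul (ai i) x z.
have -> : grad (lagrangian f a ^~ (dual_next a mu x z)) (x + z) + delta *: z =
    (grad f (x + z) - grad f x - hessmul f x z) -
    \sum_i y i *: (g' i - g i - h i) + \sum_i (y i * w i) *: (g' i - g i).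
  rewrite dz (grad_lagrangian smooth) -/(g _) -/(h _).
  have -> : \sum_i dual_next a mu x z 0 i *: grad (ai i) (x + z) =
      \sum_i y i *: g' i - \sum_i (y i * w i) *: g' i.
    by rewrite -sumrB; apply: eq_bigr => i _; rewrite dual_nextE scalerBl.
  have -> : \sum_i y i *: (g' i - g i - h i) =
      \sum_i y i *: g' i - \sum_i y i *: g i - \sum_i y i *: h i.
    by rewrite -!sumrB; apply: eq_bigr => i _; rewrite !scalerBr.
  have -> : \sum_i (y i * w i) *: (g' i - g i) =
      \sum_i (y i * w i) *: g' i - \sum_i (y i * w i) *: g i.
    by rewrite -!sumrB; apply: eq_bigr => i _; rewrite !scalerBr.
  move: (grad f (x + z)) (grad f x) (hessmul f x z) => u1 u2 u3.
  move: (\sum_i y i *: g' i) (\sum_i y i *: g i) (\sum_i y i *: h i) => s1 s2 s3.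
  move: (\sum_i (y i * w i) *: g' i) (\sum_i (y i * w i) *: g i) => s4 s5.
  by apply/rowP => j; rewrite !mxE; ring.
have y0 i : 0 <= y i by rewrite divr_ge0 ?ltW.
have B2 i : norm2 (y i *: (g' i - g i - h i)) <= y i * (LH / 2 * norm2 z ^+ 2).
  have [sai lai] := sa i; rewrite norm2Z (ger0_norm (y0 i)).
  have := lipschitz_taylor_grad sai lai short_step_segment.
  exact: ler_wpM2l.
have B3 i : norm2 ((y i * w i) *: (g' i - g i)) <= y i * (th * (LG * norm2 z)).
  have [sai lai] := sa i; rewrite norm2Z normrM (ger0_norm (y0 i)) -mulrA.
  have [+ _] := lai _ _ xzf xf; rewrite addrAC subrr add0r => hg.
  apply: (ler_wpM2l (y0 i)).
  exact: ler_pM (normr_ge0 _) (norm2_ge0 _) (slope_abs i) hg.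
have B1 := lipschitz_taylor_grad sf lf short_step_segment.
have YE : Y = \sum_i y i by rewrite /Y norm1_dual.
set s := Num.sqrt (1 + Y); have s2 : s ^+ 2 = 1 + Y by rewrite sqr_sqrtr// addr_ge0.
apply: (@le_trans _ _ (LH / 2 * norm2 z ^+ 2 + Y * (LH / 2 * norm2 z ^+ 2) +
    Y * (th * (LG * norm2 z)))).
  rewrite (le_trans (norm2D _ _))// lerD//; last first.
    by rewrite (le_trans (norm2_sum _))// YE mulr_suml ler_sum.
  rewrite (le_trans (norm2D _ _))// lerD// norm2N.
  by rewrite (le_trans (norm2_sum _))// YE mulr_suml ler_sum.
have km : 0 <= kp * eta1 * mu by rewrite !mulr_ge0// ltW.
have h1 : LH / 2 * norm2 z ^+ 2 + Y * (LH / 2 * norm2 z ^+ 2) <= kp * eta1 * mu / 2 * s.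
  have := ler_wpM2l (ltW LH_gt0) z_le; have := LH_le.
  have := ler_wpM2l km sqrt_Y_ge1; rewrite -/s; lra.
have h2 : Y * (th * (LG * norm2 z)) <= kp * eta1 * mu / 16 * s.
  have Ys : Y * norm2 z <= s * b.
    apply: (@le_trans _ _ (s ^+ 2 * norm2 z)).
      by rewrite s2 ler_wpM2r// lerDr.
    by rewrite expr2 -mulrA ler_wpM2l ?sqrtr_ge0// mulrC; exact: norm2_z_sqrt.
  have lt0 : 0 <= th * LG by rewrite mulr_ge0// ltW.
  have := ler_wpM2l lt0 Ys; have := ler_wpM2r (sqrtr_ge0 (1 + Y)) LG_b_th.
  rewrite -/s; lra.
have := mulr_ge0 km (sqrtr_ge0 (1 + Y)); rewrite -/s.
by move: h1 h2; lra.
Qed.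

(** The shift [delta *: z] is the part of the residual that the regularization
leaves; its norm is at most [2 * eta2] times the tolerance at [x]. *)
Lemma short_step_SIP eta2 delta : 0 <= delta ->
  hessmul (log_barrier f a mu) x z + delta *: z = - grad_psi f a mu x ->
  norm2 z * delta / (2 * (mu * Num.sqrt (1 + Y))) <= eta2 ->
  2 * eta2 + 5 / 8 * kp * eta1 <= Num.sqrt (7 / 8) ->
  approx_SIP f a mu (x + z) (dual_next a mu x z).
Proof.
move=> d0 newton dle etaP.
have dn0 i : 0 < dual_next a mu x z 0 i.
  by apply: lt_le_trans (short_step_dual_next i); rewrite mulr_gt0// dual_gt0.
split => //; [exact: short_step_feasible|exact: short_step_complementarity|].
have s0 : 0 < Num.sqrt (1 + Y) by exact: lt_le_trans sqrt_Y_ge1.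
move: dle; rewrite ler_pdivrMr ?mulr_gt0// => dle.
have H := short_step_stationarity newton.
set g := grad _ _ in H *.
have : norm2 g <= norm2 (g + delta *: z) + norm2 z * delta.
  rewrite -[g in leLHS](addrK (delta *: z)) (le_trans (norm2D _ _))// lerD2l.
  by rewrite norm2N norm2Z ger0_norm// mulrC.
move/le_trans; apply.
have nd : 7 / 8 * (1 + Y) <= norm1 (dual_next a mu x z) + 1.
  have : 7 / 8 * Y <= norm1 (dual_next a mu x z).
    rewrite /Y /norm1 mulr_sumr ler_sum// => i _.
    by rewrite !gtr0_norm ?dual_gt0//; exact: short_step_dual_next.
  by lra.
apply: (@le_trans _ _ (mu * (Num.sqrt (7 / 8) * Num.sqrt (1 + Y)))); last first.
  by rewrite ler_wpM2l ?(ltW mu_gt0)// -sqrtrM// ler_wsqrtr.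
have := ler_wpM2r (ltW (mulr_gt0 mu_gt0 s0)) etaP.
by move: H dle; lra.
Qed.

End Short_step.

End Step.

(** * Decrease of the barrier in one iteration *)

Section Step_bound.
Context {R : realType}.
Variables (C eta1 LG LH : R).
Hypotheses (C_lt1 : C < 1) (eta1_gt0 : 0 < eta1) (LG_gt0 : 0 < LG)
  (LH_gt0 : 0 < LH).

(** The reciprocal of the predicted decrease, relative to [mu], below which a
trial step counts as short; up to the factor [C * gamma] it is also the number of
Newton steps per unit of decrease of the barrier divided by [mu]. *)
Definition step_bound (mu : R) : R :=
  8 * LG `^ (2 / 3) / ((1 - C) `^ (2 / 3) * eta1 `^ (4 / 3)) * mu `^ (- (2 / 3))
  + r_bound C eta1 LG LH mu.

Lemma powR_fracX (x : R) m k : 0 <= x ->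
  (x `^ (m%:R / k.+1%:R)) ^+ k.+1 = x ^+ m.
Proof.
by move=> x0; rewrite -powR_mulrn ?powR_ge0// -powRrM divfK ?powR_mulrn.
Qed.

Let C0 : 0 < 1 - C. Proof. by rewrite subr_gt0. Qed.

Variable mu : R.
Hypothesis mu_gt0 : 0 < mu.

Let t1 := 2 * Num.sqrt (2 * LG) / eta1 * mu `^ (- (1 / 2)).
Let t2 := LH `^ (1 / 2) / ((1 - C) `^ (1 / 2) * eta1 `^ (3 / 2)) * mu `^ (- (1 / 2)).
Let t3 := 40 `^ (1 / 5) * LG `^ (3 / 5) / ((1 - C) `^ (1 / 5) * eta1 `^ (6 / 5)) *
    mu `^ (- (3 / 5)).
Let t4 := 8 * LG `^ (2 / 3) / ((1 - C) `^ (2 / 3) * eta1 `^ (4 / 3)) * mu `^ (- (2 / 3)).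

Let step_boundE : step_bound mu = 128 + 12800 / (1 - C) ^+ 2 + (t1 + t2) + t3 + t4.
Proof. by rewrite /step_bound addrC; congr (_ + _ + _ + _); exact: mulrDl. Qed.

Let t1_ge0 : 0 <= t1.
Proof. by rewrite /t1 mulr_ge0 ?powR_ge0// divr_ge0 ?mulr_ge0 ?sqrtr_ge0 ?ltW. Qed.
Let t2_ge0 : 0 <= t2.
Proof. by rewrite /t2 mulr_ge0 ?powR_ge0// divr_ge0 ?mulr_ge0 ?powR_ge0. Qed.
Let t3_ge0 : 0 <= t3.
Proof. by rewrite /t3 mulr_ge0 ?powR_ge0// divr_ge0 ?mulr_ge0 ?powR_ge0. Qed.
Let t4_ge0 : 0 <= t4.
Proof. by rewrite /t4 mulr_ge0 ?powR_ge0// divr_ge0 ?mulr_ge0 ?powR_ge0. Qed.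

Lemma step_bound_ge128 : 128 <= step_bound mu.
Proof.
rewrite step_boundE.
have := divr_ge0 (ler0n R 12800) (sqr_ge0 (1 - C)).
by have := t1_ge0; have := t2_ge0; have := t3_ge0; have := t4_ge0; lra.
Qed.

Let t1X : t1 ^+ 2 = 8 * LG / (eta1 ^+ 2 * mu).
Proof.
rewrite /t1 powRN !(exprMn, exprVn) (powR_fracX 1 1 (ltW mu_gt0)) sqr_sqrtr ?mulr_ge0 ?ltW//.
by rewrite expr1; field; rewrite !gt_eqF.
Qed.

Let t2X : t2 ^+ 2 = LH / ((1 - C) * eta1 ^+ 3 * mu).
Proof.
rewrite /t2 powRN !(exprMn, exprVn) (powR_fracX 1 1 (ltW mu_gt0)).
rewrite (powR_fracX 1 1 (ltW LH_gt0)) (powR_fracX 1 1 (ltW C0)).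
rewrite (powR_fracX 3 1 (ltW eta1_gt0)) !expr1.
by field; rewrite !gt_eqF.
Qed.

Let t4X : t4 ^+ 3 = 512 * LG ^+ 2 / ((1 - C) ^+ 2 * eta1 ^+ 4 * mu ^+ 2).
Proof.
rewrite /t4 powRN !(exprMn, exprVn) (powR_fracX 2 2 (ltW mu_gt0)).
rewrite (powR_fracX 2 2 (ltW LG_gt0)) (powR_fracX 2 2 (ltW C0)).
rewrite (powR_fracX 4 2 (ltW eta1_gt0)).
by field; rewrite !gt_eqF.
Qed.

(** Each of the five thresholds a trial step has to meet is the inequality
[e * T < 1] for one summand [T] of [step_bound], raised to the power that clears
the fractional exponents. *)
Lemma step_bound_thresholds e : 0 <= e -> e * step_bound mu < 1 ->
  [/\ 128 * e <= 1, 12800 * e <= (1 - C) ^+ 2, 8 * LG * e ^+ 2 <= eta1 ^+ 2 * mu,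
      LH * e ^+ 2 <= (1 - C) * eta1 ^+ 3 * mu &
      512 * LG ^+ 2 * e ^+ 3 <= (1 - C) ^+ 2 * eta1 ^+ 4 * mu ^+ 2].
Proof.
move=> e0; rewrite step_boundE => eB.
have q0 := mulr_ge0 e0 (divr_ge0 (ler0n R 12800) (sqr_ge0 (1 - C))).
have q1 := mulr_ge0 e0 t1_ge0; have q2 := mulr_ge0 e0 t2_ge0.
have q3 := mulr_ge0 e0 t3_ge0; have q4 := mulr_ge0 e0 t4_ge0.
have pow_le t k (num den : R) : 0 < den -> 0 <= e * t -> e * t <= 1 ->
    t ^+ k.+1 = num / den -> num * e ^+ k.+1 <= den.
  move=> d0 et0 et1 tX; have : (e * t) ^+ k.+1 <= 1 by rewrite exprn_ile1.
  by rewrite exprMn tX mulrA ler_pdivrMr// mul1r mulrC.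
split; first lra.
- have : e * (12800 / (1 - C) ^+ 2) <= 1 by lra.
  by rewrite mulrA ler_pdivrMr ?exprn_gt0// mul1r mulrC.
- by apply: (pow_le t1) => //; rewrite ?mulr_gt0 ?exprn_gt0//; lra.
- by apply: (pow_le t2) => //; rewrite ?mulr_gt0 ?exprn_gt0//; lra.
- by apply: (pow_le t4) => //; rewrite ?mulr_gt0 ?exprn_gt0//; lra.
Qed.

End Step_bound.

Section Short_step_thresholds.
Context {R : realType}.

(** With [e] the predicted decrease relative to [mu], the polynomial thresholds
for [e] become the conditions defining a short step. *)
Lemma short_step_thresholds (e kp eta1 mu LG LH : R) :
  0 <= e -> 0 < kp -> 0 < eta1 -> 0 < mu -> 0 < LG ->
  128 * e <= 1 -> 12800 * e <= kp ^+ 2 ->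
  8 * LG * e ^+ 2 <= eta1 ^+ 2 * mu -> LH * e ^+ 2 <= kp * eta1 ^+ 3 * mu ->
  512 * LG ^+ 2 * e ^+ 3 <= kp ^+ 2 * eta1 ^+ 4 * mu ^+ 2 ->
  let th := Num.sqrt (2 * e) in let b := e / eta1 in
  [/\ th <= 1 / 8, th <= kp / 80, 8 * LG * b ^+ 2 <= mu,
      LG * b ^+ 2 <= kp * th * mu / 32 & LH * b ^+ 2 <= kp * eta1 * mu].
Proof.
move=> e0 kp0 eta0 mu0 LG0 e1 e2 e3 e4 e5 th b.
have th2 : th ^+ 2 = 2 * e by rewrite sqr_sqrtr// mulr_ge0.
have th0 : 0 <= th by exact: sqrtr_ge0.
have bE k : b ^+ k = e ^+ k / eta1 ^+ k by rewrite exprMn exprVn.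
have b0 : 0 <= b by rewrite divr_ge0// ltW.
have ek k : 0 < eta1 ^+ k by rewrite exprn_gt0.
have sqr_le (u v : R) : 0 <= u -> 0 <= v -> u ^+ 2 <= v ^+ 2 -> u <= v.
  by move=> u0 v0; rewrite ler_pXn2r.
clearbody th b; split.
- by apply: sqr_le => //; rewrite th2; clear -e1; lra.
- apply: sqr_le => //; first by rewrite divr_ge0// ltW.
  by rewrite th2 exprMn exprVn; clear -e2; lra.
- by rewrite bE mulrA ler_pdivrMr//; clear -e3; lra.
- apply: sqr_le.
  + by rewrite mulr_ge0 ?sqr_ge0 ?(ltW LG0).
  + by rewrite divr_ge0// !mulr_ge0// ltW.
  have -> : (kp * th * mu / 32) ^+ 2 = kp ^+ 2 * e * mu ^+ 2 / 512.
    by rewrite !exprMn th2; field.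
  rewrite exprMn -exprM bE mulrA ler_pdivrMr//.
  by have := ler_wpM2l e0 e5; clear; lra.
- by rewrite bE mulrA ler_pdivrMr//; clear -e4; lra.
Qed.

End Short_step_thresholds.

Section Psi.
Context {R : realType} {n q : nat}.
Variables (f : 'rV[R]_n -> R) (a : 'rV[R]_n -> 'rV[R]_q).

Lemma psiE mu x : strictly_feasible a x -> psi f a mu x = (log_barrier f a mu x)%:E.
Proof. by move=> ax; rewrite /psi ifT//; apply/forallP. Qed.

Lemma psi_fin_strictly_feasible mu x (c : R) :
  (psi f a mu x <= c%:E)%E -> strictly_feasible a x.
Proof. by rewrite /psi; case: ifPn => [/forallP|]//; rewrite leye_eq. Qed.

End Psi.

Section Iteration.
Context {R : realType} {n q : nat}.
Variables (f : 'rV[R]_n -> R) (a : 'rV[R]_n -> 'rV[R]_q) (LG LH : R).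
Hypothesis f_convex : convex_function setT f.
Hypothesis a_concave : forall i, convex_function setT (fun x => - a x 0 i).
Hypothesis smooth : smooth_assumption f a LG LH.
Hypotheses (LG_gt0 : 0 < LG) (LH_gt0 : 0 < LH).
Variables (C gamma eta1 eta2 : R).
Hypotheses (C_range : 0 < C /\ C < 1 / 2) (gamma_range : 0 < gamma /\ gamma < 1)
  (eta1_gt0 : 0 < eta1)
  (eta12 : 2 * eta2 + 5 / 8 * (1 - C) * eta1 <= Num.sqrt (7 / 8)).
Variables (mu : R) (x d : 'rV[R]_n) (delta : R).
Hypotheses (mu_gt0 : 0 < mu) (ax : strictly_feasible a x).
Hypothesis newton : newton_direction f a C eta1 eta2 mu x delta d.

Let Y := norm1 (dual a mu x).
Let p := dot d (hessmul (log_barrier f a mu) x d).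
Let m := - model f a mu x d.

Let delta_ge0 : 0 <= delta. Proof. by have [] := newton. Qed.

Let newton_eq : hessmul (log_barrier f a mu) x d + delta *: d = - grad_psi f a mu x.
Proof. by have [_ + _ _] := newton; rewrite mulmx_hess_psi_shift. Qed.

Let grad_dot : dot (grad_psi f a mu x) d = - p - delta * norm2 d ^+ 2.
Proof.
rewrite -[grad_psi _ _ _ _]opprK -newton_eq dotNl dotDl dotZl dot_sqr opprD.
by rewrite (dotC _ d).
Qed.

Let m_eq : m = p / 2 + delta * norm2 d ^+ 2.
Proof. by rewrite /m modelE grad_dot -/p; field. Qed.

Let p_ge : mu * \sum_i slope a x d i ^+ 2 <= p.
Proof. exact: (hess_psi_ge f_convex a_concave smooth mu_gt0 ax). Qed.

Let p_ge0 : 0 <= p.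
Proof.
by apply: le_trans p_ge; rewrite mulr_ge0 ?(ltW mu_gt0)// sumr_ge0// => i _; exact: sqr_ge0.
Qed.

Let m_ge_p : p / 2 <= m.
Proof. by rewrite m_eq lerDl mulr_ge0 ?sqr_ge0. Qed.

Let Y_ge0 : 0 <= Y. Proof. exact: norm1_ge0. Qed.

Let sqrt_Y_gt0 : 0 < Num.sqrt (1 + Y).
Proof. by rewrite sqrtr_gt0 ltr_pwDl. Qed.

Let m_ge_d : eta1 * (mu * Num.sqrt (1 + Y) * norm2 d) <= m.
Proof.
have [_ _ + _] := newton; rewrite -/m -/Y.
have [->|d0] := eqVneq (norm2 d) 0.
  by rewrite mulr0 invr0 mulr0 => h; exfalso; have := eta1_gt0; lra.
by rewrite ler_pdivlMr// mulr_gt0 ?(mulr_gt0 mu_gt0)// lt0r d0 norm2_ge0.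
Qed.

(** The model is convex along [d] and vanishes at 0. *)
Lemma model_scale_le alpha : 0 <= alpha <= 1 ->
  alpha * m <= - model f a mu x (alpha *: d).
Proof.
case/andP => a0 a1; rewrite modelE dotZr grad_dot.
have -> : dot (alpha *: d) (hessmul (log_barrier f a mu) x (alpha *: d)) = alpha ^+ 2 * p.
  by rewrite /p !hessmulE -scalemxAl dotZl dotZr; ring.
have a1' : 0 <= 1 - alpha by rewrite subr_ge0.
by rewrite m_eq; have := mulr_ge0 (mulr_ge0 a0 p_ge0) a1'; lra.
Qed.

Let m_ge0 : 0 <= m.
Proof. by apply: le_trans m_ge_p; rewrite divr_ge0. Qed.

(** The acceptance test on the direction bounds [norm2 d] by
[m / (eta1 * mu * Num.sqrt (1 + Y))], and [hess_psi_ge] bounds the squared slopes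
by [2 * m / mu]. *)
Lemma trial_step_short alpha : 0 <= alpha <= 1 ->
  alpha * m / mu * step_bound C eta1 LG LH mu < 1 ->
  let e := alpha * m / mu in let th := Num.sqrt (2 * e) in
  let b := e / eta1 in let z := alpha *: d in let kp := 1 - C in
  [/\ norm2 z ^+ 2 * (1 + Y) <= b ^+ 2, \sum_i slope a x z i ^+ 2 <= th ^+ 2,
      th <= 1 / 8 /\ th <= kp / 80,
      8 * LG * b ^+ 2 <= mu /\ LG * b ^+ 2 <= kp * th * mu / 32 &
      LH * b ^+ 2 <= kp * eta1 * mu].
Proof.
move=> a01 eB e th b z kp; have [a0 a1] := andP a01.
have C1 : C < 1 by case: C_range; lra.
have kp0 : 0 < kp by rewrite subr_gt0.
have e0 : 0 <= e by rewrite divr_ge0 ?mulr_ge0// ltW.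
have [e1 e2 e3 e4 e5] :=
  step_bound_thresholds C1 eta1_gt0 LG_gt0 LH_gt0 mu_gt0 e0 eB.
have [h1 h2 h3 h4 h5] :=
  short_step_thresholds e0 kp0 eta1_gt0 mu_gt0 LG_gt0 e1 e2 e3 e4 e5.
clear e1 e2 e3 e4 e5 eB.
have th2 : th ^+ 2 = 2 * e by rewrite sqr_sqrtr// mulr_ge0.
have b0 : 0 <= b by rewrite divr_ge0// ltW.
split => //.
- rewrite norm2Z ger0_norm//.
  have h : alpha * norm2 d * Num.sqrt (1 + Y) <= b.
    rewrite /b /e ler_pdivlMr// ler_pdivlMr//.
    by have := ler_wpM2l a0 m_ge_d; lra.
  have : (alpha * norm2 d * Num.sqrt (1 + Y)) ^+ 2 <= b ^+ 2.
    by rewrite ler_pXn2r ?nnegrE// !mulr_ge0.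
  by rewrite [in X in X -> _]exprMn (@sqr_sqrtr _ (1 + Y)) ?addr_ge0.
- have -> : \sum_i slope a x z i ^+ 2 = alpha ^+ 2 * \sum_i slope a x d i ^+ 2.
    by rewrite mulr_sumr; apply: eq_bigr => i _; rewrite /slope dotZr -mulrA exprMn.
  rewrite th2 /e mulrA ler_pdivlMr//.
  have h : mu * \sum_i slope a x d i ^+ 2 <= 2 * m.
    by have := p_ge; have := m_ge_p; lra.
  have := ler_wpM2l (sqr_ge0 alpha) h.
  have : alpha ^+ 2 * (2 * m) <= alpha * (2 * m).
    by rewrite ler_wpM2r ?mulr_ge0// expr2 ler_piMl.
  by lra.
Qed.

(** If the decrease were smaller, the trial step rejected by backtracking, or
the full step, would be short. Armijo's condition would then hold at it, so the
step taken would be the full one; being short, it would reach an approximate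
stationary point. *)
Lemma inner_decrease alpha : step_size f a C gamma mu x d alpha ->
  ~ approx_SIP f a mu (x + alpha *: d) (dual_next a mu x d) ->
  strictly_feasible a (x + alpha *: d) /\
  C * gamma * mu <= step_bound C eta1 LG LH mu *
    (log_barrier f a mu x - log_barrier f a mu (x + alpha *: d)).
Proof.
move=> [al0 al1 armijo alt] notSIP.
have [[C0 C12] [g0 g1]] := (C_range, gamma_range).
have kp0 : 0 <= 1 - C by lra. have kp1 : 1 - C <= 1 by lra.
have armijo' := armijo; rewrite (psiE _ _ ax) in armijo.
have axz := psi_fin_strictly_feasible armijo; split => //.
move: armijo; rewrite (psiE _ _ axz) lee_fin => armijo.
have B0 : 0 < step_bound C eta1 LG LH mu.
  apply: (lt_le_trans (ltr0n R 128)); apply: step_bound_ge128 => //; lra.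
rewrite leNgt; apply/negP => contra.
(* [al'] is the step length tried before [alpha], or 1. *)
pose al' := Num.min 1 (alpha / gamma).
have al'01 : 0 <= al' <= 1.
  by rewrite le_min ler01 divr_ge0 ?(ltW al0) ?(ltW g0)//= ge_min lexx.
have al'le : gamma * al' <= alpha.
  have : al' <= alpha / gamma by rewrite ge_min lexx orbT.
  by rewrite ler_pdivlMr// mulrC.
have al01 : 0 <= alpha <= 1 by rewrite (ltW al0).
have short : al' * m / mu * step_bound C eta1 LG LH mu < 1.
  have dec : C * gamma * (al' * m) <=
      log_barrier f a mu x - log_barrier f a mu (x + alpha *: d).
    have h1 := ler_wpM2l (ltW C0) (model_scale_le al01).
    have h2 := ler_wpM2l (ltW C0) (ler_wpM2r m_ge0 al'le).
    by move: h1 h2 armijo; lra.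
  have h := ler_wpM2l (ltW B0) dec; have Cg : 0 < C * gamma by rewrite mulr_gt0.
  by rewrite mulrAC ltr_pdivrMr// mul1r -(ltr_pM2l Cg); lra.
have [z1 z2 [t1 t2] [l1 l2] l3] := trial_step_short al'01 short.
set e := al' * m / mu in z1 z2 t1 t2 l1 l2 l3.
have e0 : 0 <= e by rewrite divr_ge0 ?mulr_ge0 ?(ltW mu_gt0)//; case/andP: al'01.
have bth : eta1 * (e / eta1) = Num.sqrt (2 * e) ^+ 2 / 2.
  rewrite sqr_sqrtr; last by rewrite mulr_ge0.
  by rewrite mulrCA divff ?gt_eqF// mulr1; field.
have b0 : 0 <= e / eta1 by rewrite divr_ge0// ltW.
have axz' := short_step_feasible a_concave smooth LG_gt0 mu_gt0 ax (sqrtr_ge0 _) z1 z2 t1 l1.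
have := short_step_model_error a_concave smooth LG_gt0 LH_gt0 mu_gt0 ax kp0 kp1
  (sqrtr_ge0 _) b0 bth z1 z2 t1 t2 l1 l2 l3.
rewrite -bth.
have -> : (1 - C) * mu * (eta1 * (e / eta1)) = (1 - C) * (al' * m).
  by rewrite /e; field; rewrite !gt_eqF.
move=> err; have mz := ler_wpM2l kp0 (model_scale_le al'01).
have ok : (psi f a mu (x + al' *: d) <=
    psi f a mu x + (C * model f a mu x (al' *: d))%:E)%E.
  rewrite (psiE _ _ axz') (psiE _ _ ax) lee_fin; lra.
have alE : alpha = 1.
  by case: alt => // /lt_geF; rewrite ok.
have al'E : al' = 1.
  apply/eqP; rewrite eq_le; case/andP: al'01 => _ -> /=.
  by rewrite le_min lexx alE ler_pdivlMr// mul1r ltW.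
have [_ _ _ [|reg]] := newton.
  by move=> /lt_geF; move: ok; rewrite al'E scale1r => ->.
apply: notSIP; rewrite alE scale1r.
move: z1 z2; rewrite al'E scale1r => z1 z2.
exact: (short_step_SIP a_concave smooth LG_gt0 LH_gt0 mu_gt0 ax kp0 eta1_gt0
  (sqrtr_ge0 _) b0 bth z1 z2 t1 l1 l2 l3 delta_ge0 newton_eq reg eta12).
Qed.

End Iteration.

(** * Suboptimality after an outer iteration *)

Section Scalar_bounds.
Context {R : realType}.

Lemma ln_le_subr1 (u : R) : 0 < u -> ln u <= u - 1.
Proof. by move=> u0; have := @le_ln1Dx R (u - 1); rewrite subrKC; apply; lra. Qed.

Lemma le_quadratic_root (s t B c : R) : 0 < t -> 0 <= B ^+ 2 + 4 * t * c ->
  t * s ^+ 2 <= B * s + c -> s <= (B + Num.sqrt (B ^+ 2 + 4 * t * c)) / (2 * t).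
Proof.
move=> t0 D0 h; rewrite ler_pdivlMr ?mulr_gt0// -lerBlDl.
apply: le_trans (ler_norm _) _; rewrite -sqrtr_sqr ler_sqrt//.
have := ler_wpM2l (ltW t0) h; rewrite !expr2; lra.
Qed.

(** The maximum over [rho] is at th^-1 and equals th - 1 - ln th, which is at
most th + th^-1 - 2; on the interval from kappa^-1 to kappa this is largest at
the ends. *)
Lemma complementarity_term_le (kappa th rho : R) : 1 <= kappa ->
  kappa^-1 <= th -> th <= kappa -> 0 < rho ->
  th - th * rho + ln rho <= kappa.
Proof.
move=> k1 th1 th2 rho0; have k0 : 0 < kappa by lra.
have th0 : 0 < th by apply: lt_le_trans th1; rewrite invr_gt0.
have h1 := ln_le_subr1 (mulr_gt0 th0 rho0).
have th'0 : 0 < th^-1 by rewrite invr_gt0.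
have := ln_le_subr1 th'0; rewrite lnV// => h2.
move: h1; rewrite lnM ?posrE// => h1.
have kinv : kappa^-1 <= 1 by rewrite invf_le1.
have prod : 0 <= (kappa - th) * (1 - kappa^-1 * th^-1).
  apply: mulr_ge0; first by rewrite subr_ge0.
  rewrite subr_ge0 -invfM invf_le1 ?mulr_gt0//.
  by rewrite -ler_pdivrMl// mulr1.
have : (kappa - th) * (1 - kappa^-1 * th^-1) = kappa - th^-1 - th + kappa^-1.
  by field; rewrite !gt_eqF.
lra.
Qed.

End Scalar_bounds.

Section Bounded.
Context {R : realType} {n q : nat}.
Variables (f : 'rV[R]_n -> R) (a : 'rV[R]_n -> 'rV[R]_q) (LG LH : R).
Hypothesis f_convex : convex_function setT f.
Hypothesis a_concave : forall i, convex_function setT (fun x => - a x 0 i).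
Hypothesis smooth : smooth_assumption f a LG LH.
Hypothesis X_bounded : bounded_diameter (feasible a).
Let D := diameter (feasible a).

Lemma norm2_le_diameter x z : feasible a x -> feasible a z -> norm2 (x - z) <= D.
Proof. by move=> xX zX; apply: (ub_le_sup X_bounded); exists (x, z). Qed.

Lemma convex_lower_bound x z : feasible a x -> feasible a z ->
  f x - norm2 (grad f x) * D <= f z.
Proof.
move=> xX zX; have [[[df _ _] _] _] := smooth.
have := convex_grad_le (z - x) f_convex (df x); rewrite (addrC x) subrK.
have := cauchy_schwarz (- grad f x) (z - x); rewrite dotNl norm2N.
have := ler_wpM2l (norm2_ge0 (grad f x)) (norm2_le_diameter zX xX); lra.
Qed.

Lemma concave_upper_bound i x z : feasible a x -> feasible a z ->
  a z 0 i <= a x 0 i + norm2 (grad (fun x => a x 0 i) x) * D.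
Proof.
move=> xX zX; have [_ /(_ i)[[da _ _] _]] := smooth.
have := concave_grad_ge x (z - x) (a_concave i) da; rewrite (addrC x) subrK.
have := cauchy_schwarz (grad (fun x => a x 0 i) x) (z - x).
have := ler_wpM2l (norm2_ge0 (grad (fun x => a x 0 i) x)) (norm2_le_diameter zX xX); lra.
Qed.

Lemma fstar_has_lbound x : feasible a x -> has_lbound (f @` feasible a).
Proof.
move=> xX; exists (f x - norm2 (grad f x) * D) => _ [z zX <-].
exact: convex_lower_bound.
Qed.

Lemma fstar_le x : feasible a x -> fstar f a <= f x.
Proof.
by move=> xX; apply: ge_inf; [exact: fstar_has_lbound xX|exists x].
Qed.

Lemma log_barrier_lower_bound mu x : 0 < mu -> feasible a x ->
  exists c, forall z, strictly_feasible a z -> c <= log_barrier f a mu z.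
Proof.
move=> mu0 xX.
exists (f x - norm2 (grad f x) * D -
  mu * \sum_i (a x 0 i + norm2 (grad (fun x => a x 0 i) x) * D)) => z zX.
have zX' : feasible a z by move=> i; exact/ltW.
rewrite /log_barrier lerB ?convex_lower_bound// ler_wpM2l ?(ltW mu0)//.
apply: ler_sum => i _; apply: le_trans (concave_upper_bound i xX zX').
by have := ln_le_subr1 (zX i); lra.
Qed.

(** The lower bound on the barrier makes its infimum finite, so that [fine]
returns the actual gap rather than a default value. *)
Lemma psi_star_le mu x z : 0 < mu -> strictly_feasible a x ->
  strictly_feasible a z -> log_barrier f a mu x - log_barrier f a mu z <=
    fine (psi f a mu x - psi_star f a mu)%E.
Proof.
move=> mu0 ax az; have axw : feasible a x by move=> i; exact/ltW.
have azw : feasible a z by move=> i; exact/ltW.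
have [c cP] := log_barrier_lower_bound mu0 axw.
have pz : (psi_star f a mu <= (log_barrier f a mu z)%:E)%E.
  by rewrite -psiE//; apply: ereal_inf_lbound; exists z.
have pc : (c%:E <= psi_star f a mu)%E.
  apply: le_ereal_inf_tmp => _ [u _ <-]; rewrite /psi.
  case: ifPn => [/forallP /cP|]; first by rewrite lee_fin.
  by rewrite leey.
rewrite psiE//; move: pz pc; case: (psi_star f a mu) => [r| |] //=.
by rewrite !lee_fin; lra.
Qed.

(** Weak duality at an approximate stationary point of the Lagrangian: the
gradient inequalities of the objective and of the constraints add up. *)
Lemma lagrangian_gap x z (y : 'rV[R]_q) : feasible a x -> feasible a z ->
  (forall i, 0 <= y 0 i) ->
  f x - f z <= dot y (a x) - dot y (a z) +
    norm2 (grad (lagrangian f a ^~ y) x) * D.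
Proof.
move=> xX zX y0; have [[[df _ _] _] sa] := smooth.
have hf := convex_grad_le (z - x) f_convex (df x); rewrite (addrC x) subrK in hf.
have ha i : a z 0 i - a x 0 i <= dot (grad (fun x => a x 0 i) x) (z - x).
  have [[da _ _] _] := sa i.
  by have := concave_grad_ge x (z - x) (a_concave i) da; rewrite (addrC x) subrK.
have hS : dot y (a z) - dot y (a x) <=
    \sum_i y 0 i * dot (grad (fun x => a x 0 i) x) (z - x).
  by rewrite -sumrB; apply: ler_sum => i _; rewrite -mulrBr ler_wpM2l.
have gE : dot (grad (lagrangian f a ^~ y) x) (z - x) =
    dot (grad f x) (z - x) -
    \sum_i y 0 i * dot (grad (fun x => a x 0 i) x) (z - x).
  rewrite (grad_lagrangian smooth) dotBl; congr (_ - _).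
  by rewrite dotC dot_sumr; apply: eq_bigr => i _; rewrite dotZr dotC.
set g := grad (lagrangian f a ^~ y) x in gE *.
have := cauchy_schwarz (- g) (z - x); rewrite dotNl norm2N gE.
have := ler_wpM2l (norm2_ge0 g) (norm2_le_diameter zX xX); lra.
Qed.

Variables (kappa sigma t mu1 : R) (xhat : 'rV[R]_n).
Hypotheses (kappa_gt1 : 1 <= kappa) (t_gt0 : 0 < t) (mu1_gt0 : 0 < mu1)
  (slater : forall i, t <= a xhat 0 i).
Let lambda := lambda_bound q kappa D mu1 t (f xhat - fstar f a).
Let W := W_bound q kappa D lambda.

Let xhatX : feasible a xhat.
Proof. by move=> i; rewrite (le_trans _ (slater i))// ltW. Qed.

Lemma diameter_ge0 : 0 <= D.
Proof.
by have := norm2_le_diameter xhatX xhatX; rewrite subrr norm2_0.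
Qed.

Let kappa_gt0 : 0 < kappa. Proof. exact: lt_le_trans kappa_gt1. Qed.

Variables (mu mu' : R) (x' : 'rV[R]_n) (y' : 'rV[R]_q).
Hypotheses (update : annealing_update f a kappa sigma mu x' y' mu')
  (mu'_le : mu' <= mu1).

Let mu'_gt0 : 0 < mu'. Proof. by have [] := update. Qed.
Let x'X : feasible a x'. Proof. by have [] := update. Qed.

Let prod_gt0 i : 0 < a x' 0 i * y' 0 i.
Proof.
have [_ _ _ _ /(_ i)[h _]] := update.
have : 0 < a x' 0 i * y' 0 i / mu' by apply: lt_le_trans h; rewrite invr_gt0.
by rewrite pmulr_lgt0 ?invr_gt0.
Qed.

Lemma annealing_update_strictly_feasible : strictly_feasible a x'.
Proof.
move=> i; have := prod_gt0 i; have := x'X i; rewrite le_eqVlt => /predU1P[<-|//].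
by rewrite mul0r ltxx.
Qed.

Let y'_gt0 i : 0 < y' 0 i.
Proof. by have := prod_gt0 i; rewrite pmulr_rgt0// annealing_update_strictly_feasible. Qed.

Let prod_le i : y' 0 i * a x' 0 i <= kappa * mu'.
Proof.
by have [_ _ _ _ /(_ i)[_]] := update; rewrite ler_pdivrMr// mulrC.
Qed.

Let dot_prod_le : dot y' (a x') <= kappa * q%:R * mu'.
Proof.
have -> : kappa * q%:R * mu' = \sum_(i < q) kappa * mu'.
  by rewrite sumr_const card_ord -mulr_natr; ring.
by apply: ler_sum => i _.
Qed.

Let s := Num.sqrt (1 + norm1 y').

Let norm1_y' : norm1 y' = \sum_i y' 0 i.
Proof. by apply: eq_bigr => i _; rewrite gtr0_norm. Qed.

Let gap_le z : feasible a z ->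
  f x' - f z <= dot y' (a x') - dot y' (a z) + kappa * mu' * s * D.
Proof.
move=> zX; have [_ _ _ gr _] := update.
have := lagrangian_gap x'X zX (fun i => ltW (y'_gt0 i)).
have := ler_wpM2r diameter_ge0 gr; rewrite -/s; lra.
Qed.

(* The duality gap at the Slater point bounds [t * norm1 y'] from above by an
   expression linear in [s], whereas [norm1 y'] is [s ^+ 2 - 1]. *)
Let s_le : s <= lambda.
Proof.
have fx' := fstar_le x'X; have fh := fstar_le xhatX.
have := gap_le xhatX.
have : t * norm1 y' <= dot y' (a xhat).
  rewrite norm1_y' mulr_sumr; apply: ler_sum => i _.
  by rewrite mulrC ler_wpM2l// ltW.
have s2 : s ^+ 2 = 1 + norm1 y' by rewrite sqr_sqrtr// addr_ge0.
have s0 : 0 <= s by exact: sqrtr_ge0.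
have := dot_prod_le => h1 h2 h3.
have kq0 : 0 <= kappa * q%:R by rewrite mulr_ge0// ltW.
have h4 := ler_wpM2l kq0 mu'_le.
have kD : 0 <= kappa * s * D by rewrite !mulr_ge0 ?diameter_ge0// ltW.
have h5 := ler_wpM2l kD mu'_le.
rewrite /lambda /lambda_bound -!exprMn; apply: le_quadratic_root => //.
  rewrite addr_ge0 ?sqr_ge0// mulr_ge0 ?mulr_ge0 ?(ltW t_gt0)//.
  rewrite addr_ge0 ?(ltW t_gt0)// addr_ge0 ?subr_ge0//.
  by rewrite mulr_ge0// ltW.
by rewrite s2; lra.
Qed.

Let W_split : kappa * q%:R * mu' + kappa * mu' * s * D <= W * mu'.
Proof.
have h : 0 <= kappa * mu' * D by rewrite !mulr_ge0 ?diameter_ge0// ltW.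
by have := ler_wpM2l h s_le; rewrite /W /W_bound; lra.
Qed.

Lemma annealing_update_gap : f x' - fstar f a <= W * mu'.
Proof.
rewrite lerBlDr addrC -lerBlDr; apply: lb_le_inf; first by exists (f x'); exists x'.
move=> _ [z zX <-].
have : 0 <= dot y' (a z).
  by apply: sumr_ge0 => i _; rewrite mulr_ge0 ?(ltW (y'_gt0 i))//; exact: zX.
by have := gap_le zX; have := W_split; have := dot_prod_le; lra.
Qed.

(** The barrier gap at [z] is the gap of the objective, bounded by weak duality,
plus a difference of logarithms. Each logarithm is absorbed by the change of the
corresponding complementarity product ([complementarity_term_le]), which weak
duality leaves in its bound. *)
Lemma annealing_update_barrier_gap z : strictly_feasible a z ->
  log_barrier f a mu' x' - log_barrier f a mu' z <= W * mu'.
Proof.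
move=> az; have zX : feasible a z by move=> i; exact: ltW.
have ax' := annealing_update_strictly_feasible.
have term i : y' 0 i * a x' 0 i - y' 0 i * a z 0 i +
    mu' * (ln (a z 0 i) - ln (a x' 0 i)) <= kappa * mu'.
  have [_ _ _ _ /(_ i)[h1 h2]] := update.
  have r0 : 0 < a z 0 i / a x' 0 i by rewrite divr_gt0.
  have := complementarity_term_le kappa_gt1 h1 h2 r0.
  rewrite ln_div ?posrE// => /(ler_wpM2l (ltW mu'_gt0)).
  have -> : mu' * (a x' 0 i * y' 0 i / mu' -
      a x' 0 i * y' 0 i / mu' * (a z 0 i / a x' 0 i) + (ln (a z 0 i) - ln (a x' 0 i))) =
      y' 0 i * a x' 0 i - y' 0 i * a z 0 i + mu' * (ln (a z 0 i) - ln (a x' 0 i)).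
    by field; rewrite !gt_eqF.
  by rewrite (mulrC mu' kappa).
have : dot y' (a x') - dot y' (a z) + mu' * (\sum_i ln (a z 0 i) - \sum_i ln (a x' 0 i))
    <= kappa * q%:R * mu'.
  have -> : kappa * q%:R * mu' = \sum_(i < q) kappa * mu'.
    by rewrite sumr_const card_ord -mulr_natr; ring.
  by rewrite -!sumrB mulr_sumr -big_split; apply: ler_sum => i _; exact: term.
have := gap_le zX; have := W_split; rewrite /log_barrier; lra.
Qed.

End Bounded.

(** * Executions *)

Section Transitions.
Context {R : realType} {n q : nat}.
Variables (f : 'rV[R]_n -> R) (a : 'rV[R]_n -> 'rV[R]_q).
Variables (C gamma eta1 eta2 kappa sigma : R).

Lemma inner_iteration_continue mu x x' :
  inner_iteration f a C gamma eta1 eta2 mu x (Continue x') ->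
  exists delta d alpha, [/\ newton_direction f a C eta1 eta2 mu x delta d,
    step_size f a C gamma mu x d alpha,
    ~ approx_SIP f a mu (x + alpha *: d) (dual_next a mu x d) &
    x' = x + alpha *: d].
Proof.
move=> H; inversion H as [| |delta d alpha _ nd ss ns]; subst.
by exists delta, d, alpha.
Qed.

Lemma transition_cases j k mu x st :
  transition f a C gamma eta1 eta2 kappa sigma (State j k mu x) st ->
  (exists2 x', inner_iteration f a C gamma eta1 eta2 mu x (Continue x') &
     st = State j k.+1 mu x') \/
  (exists x' y' mu', annealing_update f a kappa sigma mu x' y' mu' /\
     st = State j.+1 1 mu' x').
Proof.
move=> H; inversion H as [? ? ? ? x' ii|? ? ? ? ? ? x' y' mu' _ au]; subst.
  by left; exists x'.
by right; exists x', y', mu'.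
Qed.

End Transitions.

Section Execution.
Context {R : realType} {n q : nat}.
Variables (f : 'rV[R]_n -> R) (a : 'rV[R]_n -> 'rV[R]_q) (LG LH : R).
Hypothesis f_convex : convex_function setT f.
Hypothesis a_concave : forall i, convex_function setT (fun x => - a x 0 i).
Hypothesis smooth : smooth_assumption f a LG LH.
Hypotheses (LG_gt0 : 0 < LG) (LH_gt0 : 0 < LH).
Variables (C gamma eta1 eta2 kappa sigma : R).
Hypotheses (C_range : 0 < C /\ C < 1 / 2) (gamma_range : 0 < gamma /\ gamma < 1)
  (eta1_gt0 : 0 < eta1)
  (eta12 : 2 * eta2 + 5 / 8 * (1 - C) * eta1 <= Num.sqrt (7 / 8)).
Variables (s : nat -> @state R n).
Hypothesis s_step : forall N,
  transition f a C gamma eta1 eta2 kappa sigma (s N) (s N.+1).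

Let B mu := step_bound C eta1 LG LH mu.

Let B_gt0 mu : 0 < mu -> 0 < B mu.
Proof.
move=> mu0; apply: (lt_le_trans (ltr0n R 128)); apply: step_bound_ge128 => //.
Qed.

(** A run of the fixed-barrier algorithm cannot decrease the barrier by more
than the initial gap [G], so it returns after a bounded number of steps. *)
Lemma inner_run N0 j mu x G : s N0 = State j 1 mu x -> 0 < mu ->
  strictly_feasible a x ->
  (forall z, strictly_feasible a z ->
    log_barrier f a mu x - log_barrier f a mu z <= G) ->
  exists i mu' x' y', [/\ s (N0 + i).+1 = State j.+1 1 mu' x',
    annealing_update f a kappa sigma mu x' y' mu' &
    i%:R <= G / (C * gamma * mu) * B mu].
Proof.
move=> s0 mu0 ax GP; have [[C0 _] [g0 _]] := (C_range, gamma_range).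
have c0 : 0 < C * gamma * mu by rewrite !mulr_gt0.
have B0 := B_gt0 mu0.
pose found := exists i mu' x' y', [/\ s (N0 + i).+1 = State j.+1 1 mu' x',
    annealing_update f a kappa sigma mu x' y' mu' &
    i%:R <= G / (C * gamma * mu) * B mu].
have bound k xk : strictly_feasible a xk ->
    k%:R * (C * gamma * mu) <=
      B mu * (log_barrier f a mu x - log_barrier f a mu xk) ->
    k%:R <= G / (C * gamma * mu) * B mu.
  move=> axk h; rewrite mulrAC ler_pdivlMr//; apply: (le_trans h).
  by rewrite mulrC ler_wpM2r ?(ltW B0)//; exact: GP.
have prog k : found \/ exists xk, [/\ s (N0 + k)%N = State j k.+1 mu xk,
    strictly_feasible a xk & k%:R * (C * gamma * mu) <=
      B mu * (log_barrier f a mu x - log_barrier f a mu xk)].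
  elim: k => [|k [|[xk [sk axk dk]]]]; first by
      right; exists x; rewrite addn0 subrr mulr0 mul0r.
    by left.
  have := s_step (N0 + k)%N; rewrite sk => /transition_cases.
  case=> [[x' /inner_iteration_continue[delta [d [alpha [nd ss ns ->]]]] sk1]|].
    have [ax' dec] := inner_decrease f_convex a_concave smooth LG_gt0 LH_gt0
      C_range gamma_range eta1_gt0 eta12 mu0 axk nd ss ns.
    right; exists (xk + alpha *: d); split => //; first by rewrite addnS.
    by rewrite -natr1 mulrDl mul1r; move: dec dk; rewrite -/(B mu); lra.
  case=> [x' [y' [mu' [au sk1]]]]; left.
  by exists k, mu', x', y'; split => //; exact: bound axk dk.
have [k kP] : exists k : nat, G / (C * gamma * mu) * B mu < k%:R.
  by exists (Num.trunc (G / (C * gamma * mu) * B mu)).+1; exact: truncnS_gt.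
have [//|[xk [_ axk /(bound _ _ axk)]]] := prog k.
by rewrite leNgt kP.
Qed.

End Execution.

(** * Counting outer iterations and Newton steps *)

Section Real_powers.
Context {R : realType}.

Lemma powR_Nle (x y p : R) : 0 < x -> x <= y -> 0 <= p ->
  y `^ (- p) <= x `^ (- p).
Proof.
move=> x0 xy p0; have y0 : 0 < y by exact: lt_le_trans xy.
rewrite !powRN lef_pV2 ?posrE ?powR_gt0//.
by apply: ge0_ler_powR => //; rewrite nnegrE ltW.
Qed.

Lemma geometric_small (sigma c eps : R) : 0 < sigma -> sigma < 1 -> 0 < c ->
  0 < eps -> exists k, c * sigma ^+ k <= eps.
Proof.
move=> s0 s1 c0 e0; have ls : 0 < - ln sigma by rewrite oppr_gt0 ln_lt0// s0.
pose k := (Num.trunc ((ln c - ln eps) / - ln sigma)).+1; exists k.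
have : (ln c - ln eps) / - ln sigma < k%:R by exact: truncnS_gt.
rewrite ltr_pdivrMr// => h.
rewrite -ler_ln ?posrE ?mulr_gt0 ?exprn_gt0// lnM ?posrE ?exprn_gt0// lnXn//.
by rewrite -mulr_natl; lra.
Qed.

End Real_powers.

Section Counting.
Context {R : realType}.
Variables (W eps sigma cg c A1 : R) (r : R -> R) (mu_ : nat -> R) (N_ : nat -> nat).
Hypotheses (W_gt0 : 0 < W) (eps_gt0 : 0 < eps) (sigma_gt0 : 0 < sigma)
  (sigma_lt1 : sigma < 1) (cg_gt0 : 0 < cg) (c_ge0 : 0 <= c).
Hypothesis mu_gt0 : forall j, 0 < mu_ j.
Hypothesis mu_step : forall j, mu_ j.+1 <= sigma * mu_ j.
Hypothesis r_ge0 : forall mu, 0 < mu -> 0 <= r mu.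
Hypothesis r_anti : forall x y, 0 < x -> x <= y -> r y <= r x.
Hypothesis N_first : (N_ 1)%:R <= 1 + A1.
Hypothesis N_next : forall j, (0 < j)%N ->
  (N_ j.+1)%:R <= (N_ j)%:R + 1 + W / cg * (c * mu_ j `^ (- (2 / 3)) + r (mu_ j)).

Let rho := sigma `^ (2 / 3).

Let rho_gt0 : 0 < rho. Proof. exact: powR_gt0. Qed.
Let rho_lt1 : rho < 1.
Proof.
have : sigma `^ (2 / 3) < 1 `^ (2 / 3).
  by apply: gt0_ltr_powR; rewrite ?nnegrE ?divr_gt0// ltW.
by rewrite powR1.
Qed.

Let mu_pow_step j : mu_ j `^ (- (2 / 3)) <= rho * mu_ j.+1 `^ (- (2 / 3)).
Proof.
have -> : rho * mu_ j.+1 `^ (- (2 / 3)) = (mu_ j.+1 / sigma) `^ (- (2 / 3)).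
  rewrite powRM ?invr_ge0 ?ltW// mulrC; congr (_ * _).
  by rewrite -(powR_inv1 (ltW sigma_gt0)) -powRrM mulrNN mul1r.
apply: powR_Nle; rewrite ?divr_gt0//.
by rewrite ler_pdivrMr// mulrC.
Qed.

Lemma barrier_geometric j : mu_ j <= mu_ 0 * sigma ^+ j.
Proof.
elim: j => [|j IHj]; first by rewrite mulr1.
apply: (le_trans (mu_step j)); rewrite exprS mulrCA ler_wpM2l//; exact: ltW.
Qed.

(** The sum of the powers [mu_ k `^ (- (2 / 3))] over [0 < k < J] is dominated by a geometric series of ratio [rho] read backwards,
hence by its last term, for which the parameter still exceeds [eps / W]. *)
Lemma newton_steps_le J : (0 < J)%N ->
  (forall j, (0 < j)%N -> (j < J)%N -> eps < W * mu_ j) ->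
  (N_ J)%:R <= J%:R + A1 +
    W / cg * (c * ((eps / W) `^ (- (2 / 3)) / (1 - rho)) + J%:R * r (eps / W)).
Proof.
move=> J0 big; have eW : 0 < eps / W by rewrite divr_gt0.
have d0 : 0 < 1 - rho by rewrite subr_gt0.
have mu_big j : (0 < j)%N -> (j < J)%N -> eps / W <= mu_ j.
  by move=> j0 jJ; rewrite ler_pdivrMr// mulrC ltW// big.
(* [T k] bounds the sum of the powers over the outer starts 1, ..., k: the bound
   reproduces itself because its value at k is at most rho times that at k + 1. *)
pose T k := if k is 0 then 0 else mu_ k `^ (- (2 / 3)) / (1 - rho).
have T_step k : T k + mu_ k.+1 `^ (- (2 / 3)) <= T k.+1.
  rewrite /T; case: k => [|k].
    by rewrite add0r ler_pdivlMr// ler_piMr ?powR_ge0// gerBl ltW.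
  rewrite ler_pdivlMr// mulrDl divfK ?gt_eqF//.
  by have := mu_pow_step k.+1; lra.
have T_le k : (k < J)%N -> T k <= (eps / W) `^ (- (2 / 3)) / (1 - rho).
  rewrite /T; case: k => [_|k kJ]; first by rewrite divr_ge0 ?powR_ge0// ltW.
  by rewrite ler_pM2r ?invr_gt0//; apply: powR_Nle => //; exact: mu_big.
have Wc : 0 <= W / cg by rewrite divr_ge0// ltW.
have main k : (k < J)%N -> (N_ k.+1)%:R <=
    k.+1%:R + A1 + W / cg * (c * T k + k%:R * r (eps / W)).
  elim: k => [_|k IHk kJ]; first by rewrite mulr0 mul0r addr0 mulr0 addr0.
  apply: (le_trans (N_next _)) => //.
  have := IHk (ltnW kJ); have h := r_anti eW (mu_big k.+1 isT kJ).
  have h1 := ler_wpM2l c_ge0 (T_step k).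
  have : W / cg * (c * mu_ k.+1 `^ (- (2 / 3)) + r (mu_ k.+1) +
      (c * T k + k%:R * r (eps / W))) <=
      W / cg * (c * T k.+1 + k.+1%:R * r (eps / W)).
    rewrite ler_wpM2l// -natr1; lra.
  by rewrite -(natr1 k.+1); lra.
case: J J0 big mu_big T_le main => // J _ _ _ T_le main.
apply: (le_trans (main J (ltnSn J))).
rewrite lerD2l ler_wpM2l// lerD//; first by rewrite ler_wpM2l// T_le.
by rewrite ler_wpM2r ?r_ge0// ler_nat.
Qed.

(** [J] is the first positive index with [W * mu_ J <= eps]. When it exceeds 1,
its predecessor fails the test, while [mu_] has shrunk by [sigma] at each
step. The summand [1 / sigma] keeps the logarithm nonnegative when [J] is 1. *)
Lemma outer_iterations_le : exists J, [/\ (0 < J)%N, W * mu_ J <= eps,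
  forall j, (0 < j)%N -> (j < J)%N -> eps < W * mu_ j &
  J%:R <= 2 + ln (W * mu_ 0 / eps + 1 / sigma) / ln (1 / sigma)].
Proof.
have ls : 0 < ln (1 / sigma) by rewrite ln_gt0// ltr_pdivlMr// mul1r.
have W0 : 0 < W * mu_ 0 by rewrite mulr_gt0.
have small : exists j, (0 < j)%N && (W * mu_ j <= eps).
  have [k kP] := geometric_small sigma_gt0 sigma_lt1 W0 eps_gt0; exists k.+1.
  apply: le_trans kP; rewrite -mulrA ler_wpM2l ?(ltW W_gt0)//.
  apply: (le_trans (barrier_geometric k.+1)).
  by rewrite exprS mulrCA ler_piMl ?(ltW sigma_lt1)// mulr_ge0 ?exprn_ge0 ?ltW.
pose J := ex_minn small; exists J; rewrite /J.
case: ex_minnP => {J} J /andP[J0 JP] Jmin.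
have big j : (0 < j)%N -> (j < J)%N -> eps < W * mu_ j.
  move=> j0 jJ; rewrite ltNge; apply: contraTN jJ => je.
  by rewrite -leqNgt Jmin// j0.
split => //; have A1' : 1 <= W * mu_ 0 / eps + 1 / sigma.
  have : 1 <= 1 / sigma by rewrite ler_pdivlMr// mul1r ltW.
  have : 0 < W * mu_ 0 / eps by rewrite divr_gt0.
  by lra.
case: J J0 {JP Jmin} big => [//|[_ _|J _ big]].
  have : 0 <= ln (W * mu_ 0 / eps + 1 / sigma) / ln (1 / sigma).
    exact: divr_ge0 (ln_ge0 A1') (ltW ls).
  lra.
have h : (1 / sigma) ^+ J.+1 <= W * mu_ 0 / eps + 1 / sigma.
  apply: (@le_trans _ _ (W * mu_ 0 / eps)); last first.
    by rewrite lerDl divr_ge0// ltW.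
  rewrite ler_pdivlMr// mul1r exprVn mulrC ler_pdivrMr ?exprn_gt0//.
  apply: (le_trans (ltW (big J.+1 isT (ltnSn _)))).
  by rewrite -mulrA ler_wpM2l ?(ltW W_gt0)// barrier_geometric.
have : J.+1%:R * ln (1 / sigma) <= ln (W * mu_ 0 / eps + 1 / sigma).
  rewrite mulr_natl -lnXn ?divr_gt0// ler_ln ?posrE ?exprn_gt0 ?divr_gt0//.
  exact: lt_le_trans A1'.
by rewrite -ler_pdivlMr// -(natr1 J.+1); lra.
Qed.

End Counting.

(** * Asymptotics *)

Section Asymptotics.
Context {R : realType}.
Variables (C gamma eta1 LG LH : R).
Hypotheses (C_lt1 : C < 1) (eta1_gt0 : 0 < eta1).

(** Monotonicity and order of growth depend on the exponents and on the signs
of the coefficients alone. *)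
Lemma r_bound_shape : exists c1 c2 c3 : R, [/\ 0 < c1, 0 <= c2, 0 <= c3 &
  forall mu, r_bound C eta1 LG LH mu =
    c1 + c2 * mu `^ (- (1 / 2)) + c3 * mu `^ (- (3 / 5))].
Proof.
pose c1 : R := 128 + 12800 / (1 - C) ^+ 2.
pose c2 := 2 * Num.sqrt (2 * LG) / eta1 +
   LH `^ (1 / 2) / ((1 - C) `^ (1 / 2) * eta1 `^ (3 / 2)).
pose c3 := 40 `^ (1 / 5) * LG `^ (3 / 5) / ((1 - C) `^ (1 / 5) * eta1 `^ (6 / 5)).
exists c1, c2, c3; split=> [| | |mu]; last exact: erefl.
- apply: ltr_pwDl; first exact: (ltr0n R 128).
  exact: divr_ge0 (ler0n R 12800) (sqr_ge0 _).
- apply: addr_ge0.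
    by apply: divr_ge0; [apply: mulr_ge0; rewrite ?sqrtr_ge0|exact: ltW].
  by apply: divr_ge0; rewrite ?mulr_ge0 ?powR_ge0.
- by apply: divr_ge0; rewrite mulr_ge0 ?powR_ge0.
Qed.

Lemma r_bound_ge0 mu : 0 <= r_bound C eta1 LG LH mu.
Proof.
have [c1 [c2 [c3 [c10 c20 c30 ->]]]] := r_bound_shape.
by rewrite !addr_ge0 ?(ltW c10)// mulr_ge0 ?powR_ge0.
Qed.

Lemma r_bound_anti x y : 0 < x -> x <= y ->
  r_bound C eta1 LG LH y <= r_bound C eta1 LG LH x.
Proof.
move=> x0 xy; have [c1 [c2 [c3 [c10 c20 c30 rE]]]] := r_bound_shape.
by rewrite !rE !lerD// ler_wpM2l// powR_Nle// divr_ge0.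
Qed.

Lemma r_bound_order : exists2 k, 0 < k & forall mu, 0 < mu -> mu <= 1 ->
  r_bound C eta1 LG LH mu <= k * mu `^ (- (3 / 5)).
Proof.
have [c1 [c2 [c3 [c10 c20 c30 rE]]]] := r_bound_shape.
exists (c1 + c2 + c3) => [|mu mu0 mu1]; first by rewrite !ltr_pwDl.
have mu01 : 0 < mu <= 1 by rewrite mu0.
have h1 : 1 <= mu `^ (- (3 / 5)).
  by rewrite -[leLHS](powRr0 mu); apply: ger_powR => //; lra.
have h2 : mu `^ (- (1 / 2)) <= mu `^ (- (3 / 5)) by apply: ger_powR => //; lra.
by rewrite rE; have := ler_wpM2l c20 h2; have := ler_wpM2l (ltW c10) h1; lra.
Qed.

Lemma r_bound_O :
  (r_bound C eta1 LG LH) =O_ (0^'+) (fun mu : R => mu `^ (- (3 / 5))).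
Proof.
have [k k0 kP] := r_bound_order; apply/eqO_exP; exists k => //.
near=> mu; have mu0 : 0 < mu by [].
have mu1 : mu <= 1 by near: mu; exact: nbhs_right_ltW.
by rewrite !ger0_norm ?powR_ge0 ?r_bound_ge0// kP.
Unshelve. all: by end_near. Qed.

Variables (W mu1 sigma gap1 : R) (J : R -> nat).
Hypotheses (C_gt0 : 0 < C) (gamma_gt0 : 0 < gamma) (W_gt0 : 0 < W)
  (mu1_gt0 : 0 < mu1) (sigma_gt0 : 0 < sigma) (sigma_lt1 : sigma < 1).
Hypothesis J_le : forall eps, 0 < eps ->
  (J eps)%:R <= 2 + ln (W * mu1 / eps + 1 / sigma) / ln (1 / sigma).

(** [J eps] is of logarithmic order and [r] at [eps / W] of order
eps^(-3/5). Near 0 both ln (1 / eps) and eps^(-3/5) are at least 1, so that they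
absorb the constants. *)
Lemma ell_bound_O :
  (fun eps : R => ell_bound C gamma eta1 LG LH W mu1 gap1 (J eps) eps)
    =O_ (0^'+) (fun eps : R => ln (1 / eps) * eps `^ (- (3 / 5))).
Proof.
have [k k0 kP] := r_bound_order.
have ls : 0 < ln (1 / sigma) by rewrite ln_gt0// ltr_pdivlMr// mul1r.
pose V := W * mu1 + 1 / sigma.
have V0 : 0 < V by rewrite addr_gt0 ?mulr_gt0 ?invr_gt0.
pose cJ := 2 + (`|ln V| + 1) / ln (1 / sigma).
have cJ0 : 0 <= cJ by rewrite addr_ge0// divr_ge0 ?addr_ge0// ltW.
rewrite /ell_bound; set A1 := gap1 / _ * _.
have Cg : 0 < C * gamma by rewrite mulr_gt0.
pose K := W * cJ / (C * gamma) * (k * W `^ (3 / 5)) + cJ + `|A1| + 1.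
have K0 : 0 < K.
  by rewrite ltr_wpDl// !addr_ge0// !mulr_ge0 ?powR_ge0 ?invr_ge0// ?mulr_ge0// ltW.
apply/eqO_exP; exists K => //.
near=> eps; have e0 : 0 < eps by [].
(* This makes ln (1 / eps) at least 1. *)
have e1 : eps <= expR (-1) by near: eps; apply: nbhs_right_ltW; exact: expR_gt0.
have eW : eps <= W by near: eps; exact: nbhs_right_ltW.
have e_le1 : eps <= 1 by rewrite (le_trans e1)// -[leRHS]expR0 ler_expR; lra.
set L := ln (1 / eps); set E := eps `^ (- (3 / 5)).
have L1 : 1 <= L.
  rewrite /L div1r lnV ?posrE// lerNr -[leRHS]expRK ler_ln ?posrE ?expR_gt0//.
have E1 : 1 <= E.
  by rewrite -[leLHS](powRr0 eps); apply: ger_powR; rewrite ?e0//; lra.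
have JL : (J eps)%:R <= cJ * L.
  apply: (le_trans (J_le e0)).
  have : ln (W * mu1 / eps + 1 / sigma) <= `|ln V| + L.
    apply: (@le_trans _ _ (ln (V / eps))).
      have sg : 0 < 1 / sigma by rewrite divr_gt0.
      have We : 0 < W * mu1 / eps by rewrite divr_gt0 ?mulr_gt0.
      rewrite ler_ln ?posrE; [|by rewrite addr_gt0|by rewrite divr_gt0].
      by rewrite /V mulrDl lerD2l ler_pdivlMr// ler_piMr// ltW.
    rewrite ln_div ?posrE// /L div1r lnV ?posrE// lerD2r; exact: ler_norm.
  have vL : `|ln V| <= `|ln V| * L by rewrite ler_peMr.
  move=> h; have h2 : ln (W * mu1 / eps + 1 / sigma) <= (`|ln V| + 1) * L by lra.
  have : ln (W * mu1 / eps + 1 / sigma) / ln (1 / sigma) <=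
      (`|ln V| + 1) * L / ln (1 / sigma) by rewrite ler_pM2r ?invr_gt0.
  rewrite /cJ; lra.
have rL : r_bound C eta1 LG LH (W^-1 * eps) <= k * W `^ (3 / 5) * E.
  apply: (le_trans (kP _ _ _)); rewrite ?mulr_gt0 ?invr_gt0//.
    by rewrite mulrC ler_pdivrMr// mul1r.
  rewrite powRM ?invr_ge0 ?(ltW W_gt0) ?(ltW e0)// -/E mulrA.
  by rewrite -(powR_inv1 (ltW W_gt0)) -powRrM mulrNN mul1r.
have r0 := r_bound_ge0 (W^-1 * eps).
have LE0 : 0 <= L * E by rewrite mulr_ge0//; lra.
have LE1 : L <= L * E by rewrite ler_peMr//; lra.
have J0 : 0 <= (J eps)%:R :> R by [].
have Wc : 0 <= W / (C * gamma) by rewrite divr_ge0// ltW.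
rewrite (ger0_norm LE0) (le_trans (ler_normD _ _))//.
rewrite ger0_norm; last first.
  by rewrite addr_ge0// mulr_ge0// mulrAC mulr_ge0.
have T1 : W * (J eps)%:R / (C * gamma) * r_bound C eta1 LG LH (W^-1 * eps) <=
    W * cJ / (C * gamma) * (k * W `^ (3 / 5)) * (L * E).
  have -> : W * cJ / (C * gamma) * (k * W `^ (3 / 5)) * (L * E) =
      W / (C * gamma) * ((cJ * L) * (k * W `^ (3 / 5) * E)) by ring.
  have -> : W * (J eps)%:R / (C * gamma) * r_bound C eta1 LG LH (W^-1 * eps) =
      W / (C * gamma) * ((J eps)%:R * r_bound C eta1 LG LH (W^-1 * eps)) by ring.
  by rewrite ler_wpM2l// ler_pM.
have T2 : (J eps)%:R <= cJ * (L * E).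
  by apply: (le_trans JL); rewrite ler_wpM2l.
have T3 : `|A1| <= `|A1| * (L * E).
  rewrite ler_peMr//; lra.
rewrite /K; lra.
Unshelve. all: by end_near. Qed.

End Asymptotics.

(** * The annealing algorithm *)

Section Outer_starts.
Context {R : realType} {n q : nat}.
Variables (f : 'rV[R]_n -> R) (a : 'rV[R]_n -> 'rV[R]_q) (LG LH : R).
Hypothesis f_convex : convex_function setT f.
Hypothesis a_concave : forall i, convex_function setT (fun x => - a x 0 i).
Hypothesis smooth : smooth_assumption f a LG LH.
Hypotheses (LG_gt0 : 0 < LG) (LH_gt0 : 0 < LH).
Variables (C gamma eta1 eta2 kappa sigma : R).
Hypotheses (C_range : 0 < C /\ C < 1 / 2) (gamma_range : 0 < gamma /\ gamma < 1)
  (eta1_gt0 : 0 < eta1)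
  (eta12 : 2 * eta2 + 5 / 8 * (1 - C) * eta1 <= Num.sqrt (7 / 8))
  (kappa_ge1 : 1 <= kappa) (sigma_lt1 : sigma < 1).
Hypothesis X_bounded : bounded_diameter (feasible a).
Variables (xhat : 'rV[R]_n) (t : R).
Hypotheses (slater : forall i, t <= a xhat 0 i) (t_gt0 : 0 < t).
Variables (x1 : 'rV[R]_n) (mu1 : R).
Hypotheses (x1_int : strictly_feasible a x1) (mu1_gt0 : 0 < mu1).
Variable s : nat -> @state R n.
Hypothesis s_exec : execution f a C gamma eta1 eta2 kappa sigma x1 mu1 s.

Let lambda := lambda_bound q kappa (diameter (feasible a)) mu1 t (f xhat - fstar f a).
Let W := W_bound q kappa (diameter (feasible a)) lambda.
Let gap1 := fine (psi f a mu1 x1 - psi_star f a mu1)%E.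
Let B mu := step_bound C eta1 LG LH mu.

(** The first starting point is given, so its barrier gap is the quantity in the
statement; every other one comes from an annealing update, which controls the gap
by the barrier parameter. Step 0 is the only start that is not an update. *)
Let gap N := if N is 0 then gap1 else W * barrier (s N).

Let start N := [/\ inner (s N) = 1%N, strictly_feasible a (point (s N)),
  0 < barrier (s N), barrier (s N) <= mu1 &
  forall z, strictly_feasible a z -> log_barrier f a (barrier (s N)) (point (s N)) -
    log_barrier f a (barrier (s N)) z <= gap N].

Let next N N' := [/\ (0 < N')%N, outer (s N') = (outer (s N)).+1,
  barrier (s N') <= sigma * barrier (s N),
  f (point (s N')) - fstar f a <= W * barrier (s N') &
  N'%:R <= N%:R + 1 + gap N / (C * gamma * barrier (s N)) * B (barrier (s N))].

Let start0 : start 0.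
Proof.
have [s0 _] := s_exec; rewrite /start /gap s0; split => //= z az.
exact: (psi_star_le f_convex a_concave smooth X_bounded).
Qed.

Let start_next N : start N -> exists N', start N' /\ next N N'.
Proof.
case sN : (s N) => [j k mu x]; rewrite /start /next sN /= => -[k1 ax mu0 mule gapP].
rewrite k1 in sN; have [_ step] := s_exec.
have [i [mu' [x' [y' [sN' au iP]]]]] := inner_run f_convex a_concave smooth LG_gt0
  LH_gt0 C_range gamma_range eta1_gt0 eta12 step sN mu0 ax gapP.
have [mu'0 mu'le _ _ _] := au.
have mu'mu1 : mu' <= mu1.
  apply: (le_trans mu'le); apply: le_trans mule.
  by rewrite ler_piMl// ltW.
exists (N + i).+1; rewrite sN' /=; split; split => //.
- exact: (annealing_update_strictly_feasible kappa_ge1 au).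
- move=> z az; rewrite sN' /=.
  exact: (annealing_update_barrier_gap f_convex a_concave smooth
    X_bounded kappa_ge1 t_gt0 mu1_gt0 slater au mu'mu1 az).
- exact: (annealing_update_gap f_convex a_concave smooth
    X_bounded kappa_ge1 t_gt0 mu1_gt0 slater au mu'mu1).
- by rewrite -natr1 natrD; move: iP; rewrite -/(B mu); lra.
Qed.

(** Since [start] implies the hypotheses of [inner_run], every run returns, and
iterating a choice of [next] enumerates the outer starts of the execution. *)
Lemma outer_starts : exists N_ : nat -> nat, let mu_ j := barrier (s (N_ j)) in
  [/\ mu_ 0 = mu1, forall j, 0 < mu_ j, forall j, mu_ j.+1 <= sigma * mu_ j,
      forall j, outer (s (N_ j)) = j.+1 /\ inner (s (N_ j)) = 1%N &
  [/\ forall j, (0 < j)%N -> f (point (s (N_ j))) - fstar f a <= W * mu_ j,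
      (N_ 1)%:R <= 1 + gap1 / (C * gamma * mu1) * B mu1 &
      forall j, (0 < j)%N ->
        (N_ j.+1)%:R <= (N_ j)%:R + 1 + W / (C * gamma) * B (mu_ j)]].
Proof.
have [nx nxP] : {nx : nat -> nat & forall N, start N -> start (nx N) /\ next N (nx N)}.
  apply: (@choice _ _ (fun N N' => start N -> start N' /\ next N N')) => N.
  have [/start_next[N' ?]|] := pselect (start N); first by exists N'.
  by exists 0%N.
pose N_ j := iter j nx 0%N; exists N_ => mu_.
have st j : start (N_ j) by elim: j => [|j /nxP[]].
have nxt j : next (N_ j) (N_ j.+1) by have [] := nxP _ (st j).
have s0 : s 0%N = State 1 1 mu1 x1 by case: s_exec.
have [C0 _] := C_range; have [g0 _] := gamma_range.
split.
- by rewrite /mu_ /N_ /= s0.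
- by move=> j; have [] := st j.
- by move=> j; have [] := nxt j.
- move=> j; split; last by have [] := st j.
  elim: j => [|j IHj]; first by rewrite /N_ /= s0.
  by have [_ -> _ _ _] := nxt j; rewrite IHj.
split.
- by case=> // j _; have [] := nxt j.
- by have [_ _ _ _] := nxt 0%N; rewrite /N_ /= s0 /= add0r.
- case=> // j _; have [_ _ _ _] := nxt j.+1; have [Npos _ _ _ _] := nxt j.
  have mu0 : 0 < mu_ j.+1 by have [] := st j.+1.
  have gapS N : (0 < N)%N -> gap N = W * barrier (s N) by case: N.
  rewrite (gapS _ Npos) -/(mu_ j.+1).
  congr (_ <= _ + _ * _); field; rewrite !gt_eqF ?mulr_gt0//.
Qed.

End Outer_starts.

Theorem theorem4 (R : realType) (n q : nat)
  (f : 'rV[R]_n -> R) (a : 'rV[R]_n -> 'rV[R]_q)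
  (f_convex : convex_function setT f)
  (a_concave : forall i, convex_function setT (fun x => - a x 0 i))
  (LG LH : R) (LG_gt0 : 0 < LG) (LH_gt0 : 0 < LH)
  (smooth : smooth_assumption f a LG LH)
  (C gamma eta1 eta2 kappa sigma : R)
  (C_range : 0 < C /\ C < 1 / 2)
  (gamma_range : 0 < gamma /\ gamma < 1)
  (eta1_range : 0 < eta1 /\ eta1 < 1 / 2)
  (eta2_range : eta1 < eta2 /\ eta2 < 1 / 2)
  (eta12 : 2 * eta2 + 5 / 8 * (1 - C) * eta1 <= Num.sqrt (7 / 8))
  (kappa_range : 2 < kappa)
  (sigma_range : 2 / kappa <= sigma /\ sigma < 1)
  (X_bounded : bounded_diameter (feasible a))
  (xhat : 'rV[R]_n) (t : R)
  (t_min : (exists i, a xhat 0 i = t) /\ (forall i, t <= a xhat 0 i))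
  (t_gt0 : 0 < t)
  (x1 : 'rV[R]_n) (mu1 : R)
  (x1_int : strictly_feasible a x1) (mu1_gt0 : 0 < mu1)
  (s : nat -> state)
  (s_exec : execution f a C gamma eta1 eta2 kappa sigma x1 mu1 s) :
  let D := diameter (feasible a) in
  let lambda := lambda_bound q kappa D mu1 t (f xhat - fstar f a) in
  let W := W_bound q kappa D lambda in
  let gap1 := fine (psi f a mu1 x1 - psi_star f a mu1)%E in
  let r := r_bound C eta1 LG LH in
  let ell := ell_bound C gamma eta1 LG LH W mu1 gap1 in
  exists J : R -> nat,
  [/\ forall eps : R, 0 < eps ->
        exists (x : 'rV[R]_n) (N : nat),
        [/\ (1 <= J eps)%N,
            reaches s (J eps).+1 x N,
            (J eps)%:R <=
              2 + ln (W * mu1 / eps + 1 / sigma) / ln (1 / sigma),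
            f x - fstar f a <= eps &
            N%:R <=
              8 * LG `^ (2 / 3) * W `^ (5 / 3) /
                ((1 - C) `^ (2 / 3) * eta1 `^ (4 / 3) * (C * gamma) *
                 (1 - sigma `^ (2 / 3))) * eps `^ (- (2 / 3)) +
              ell (J eps) eps],
      r =O_ (0^'+) (fun mu : R => mu `^ (- (3 / 5))) &
      (fun eps : R => ell (J eps) eps) =O_ (0^'+)
        (fun eps : R => ln (1 / eps) * eps `^ (- (3 / 5)))].
Proof.
move=> D lambda W gap1 r ell.
have [[C0 C12] [g0 g1]] := (C_range, gamma_range).
have eta1_gt0 : 0 < eta1 by case: eta1_range.
have C1 : C < 1 by lra.
have kappa_ge1 : 1 <= kappa by lra.
have sigma_gt0 : 0 < sigma.
  by case: sigma_range => + _; apply: lt_le_trans; rewrite divr_gt0//; lra.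
have sigma_lt1 : sigma < 1 by case: sigma_range.
have [[i0 _] slater] := t_min.
have [N_ [mu0E mu_gt0 mu_step starts [gapP N_first N_next]]] :=
  outer_starts f_convex a_concave smooth LG_gt0 LH_gt0 C_range gamma_range
    eta1_gt0 eta12 kappa_ge1 sigma_lt1 X_bounded slater t_gt0 x1_int mu1_gt0 s_exec.
pose mu_ j := barrier (s (N_ j)).
(* An index attaining the minimum exists, so there is at least one constraint. *)
have W_gt0 : 0 < W.
  have D0 : 0 <= D by exact: (diameter_ge0 X_bounded t_gt0 slater).
  have xhatX : feasible a xhat by move=> i; rewrite (le_trans _ (slater i))// ltW.
  have l0 : 0 <= lambda.
    apply: divr_ge0; last by rewrite mulr_ge0// ltW.
    by rewrite addr_ge0 ?sqrtr_ge0// !mulr_ge0 ?(ltW mu1_gt0)//; lra.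
  have q0 : (0 < q)%N by exact: leq_ltn_trans (leq0n _) (ltn_ord i0).
  rewrite mulr_gt0//; first by lra.
  by rewrite ltr_pwDl ?ltr0n// mulr_ge0.
have cg0 : 0 < C * gamma by rewrite mulr_gt0.
have c0 : 0 <= 8 * LG `^ (2 / 3) / ((1 - C) `^ (2 / 3) * eta1 `^ (4 / 3)).
  by rewrite divr_ge0// ?mulr_ge0 ?powR_ge0.
have iters eps (eps0 : 0 < eps) :=
  outer_iterations_le W_gt0 eps0 sigma_gt0 sigma_lt1 mu_gt0 mu_step.
have /choice[J JP] : forall eps, exists J, 0 < eps ->
    [/\ (0 < J)%N, W * mu_ J <= eps,
    forall j, (0 < j)%N -> (j < J)%N -> eps < W * mu_ j &
    J%:R <= 2 + ln (W * mu_ 0 / eps + 1 / sigma) / ln (1 / sigma)].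
  move=> eps; have [eps0|] := boolP (0 < eps); last by exists 0%N.
  by have [J ?] := iters _ eps0; exists J.
exists J; split; [|exact: r_bound_O|]; last first.
  apply: (ell_bound_O LG LH eta1_gt0 gap1 C0 g0 W_gt0 mu1_gt0 sigma_gt0 sigma_lt1) => eps eps0.
  by have [_ _ _] := JP _ eps0; rewrite /mu_ mu0E.
move=> eps eps0; have [J0 JW big] := JP _ eps0; rewrite /mu_ mu0E => Jle.
exists (point (s (N_ (J eps)))), (N_ (J eps)).
have [oJ iJ] := starts (J eps).
split => //; first exact: le_trans (gapP _ J0) JW.
have r_ge0 mu : 0 < mu -> 0 <= r_bound C eta1 LG LH mu.
  by move=> _; exact: r_bound_ge0.
have := newton_steps_le W_gt0 eps0 sigma_gt0 sigma_lt1 cg0 c0 mu_gt0 mu_step r_ge0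
  (r_bound_anti C LG LH eta1_gt0) N_first N_next J0 big.
move/le_trans; apply; rewrite le_eqVlt; apply/orP; left; apply/eqP.
rewrite /ell /ell_bound.
have W0 := ltW W_gt0; have e0 := ltW eps0.
have -> : (eps / W) `^ (- (2 / 3)) = W `^ (2 / 3) * eps `^ (- (2 / 3)).
  rewrite powRM ?invr_ge0// mulrC; congr (_ * _).
  by rewrite -(powR_inv1 W0) -powRrM mulrNN mul1r.
have -> : W `^ (5 / 3) = W * W `^ (2 / 3).
  rewrite -(@mulr_powRB1 _ W (5 / 3)) ?divr_gt0//.
  by congr (_ * _ `^ _); field.
have p1 : (1 - C) `^ (2 / 3) != 0 by rewrite gt_eqF// powR_gt0 ?subr_gt0.
have p2 : eta1 `^ (4 / 3) != 0 by rewrite gt_eqF// powR_gt0.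
have p3 : 1 - sigma `^ (2 / 3) != 0.
  rewrite subr_eq0 eq_sym lt_eqF//.
  have : sigma `^ (2 / 3) < 1 `^ (2 / 3).
    by apply: gt0_ltr_powR; rewrite ?nnegrE ?divr_gt0// ltW.
  by rewrite powR1.
have [p4 p5] : C != 0 /\ gamma != 0 by rewrite !gt_eqF.
rewrite [W^-1 * eps]mulrC /step_bound -/gap1.
set A1 := gap1 / _ * _; set rW := r_bound _ _ _ _ (eps / W).
move: p1 p2 p3; set v1 := (1 - C) `^ _; set v2 := eta1 `^ _.
set v3 := sigma `^ _; set v4 := LG `^ _; set v5 := W `^ _; set v6 := eps `^ _.
move: A1 rW v1 v2 v3 v4 v5 v6 => A1 rW v1 v2 v3 v4 v5 v6 p1 p2 p3.
by field; rewrite p1 p2 p3 p4 p5.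
Qed.
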